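(* Let $X_1,X_2,\dots$ be independent and identically distributed random variables with values in a measurable space $\mathcal X$, and let $h:\mathcal X^2\to\mathbb R$ be a measurable, symmetric and bounded kernel function such that the U-statistic $U_n(h)$ of degree $2$ with kernel $h$ is non-degenerate and centered. Let $(a_n)_n\in(0,\infty)^{\mathbb N}$ be a sequence with $$\lim_{n\to\infty}\frac{\sqrt n}{a_n}=0\quad\text{and}\quad\lim_{n\to\infty}\frac{n}{a_n}=\infty .$$ Then the sequence $\left(\frac{n}{a_n}U_n(h)\right)_n$ satisfies the moderate deviation principle with speed $s_n:=\frac{a_n^2}{n}$ and good rate function $$I(x)=\sup_{\lambda\in\mathbb R}\{\lambda x-2\lambda^2\sigma_1^2\}=\frac{x^2}{8\sigma_1^2}.$$
   Context: The U-statistic of degree $2$ with kernel $h$ is $$U_n(h):=\frac1{\binom n2}\sum_{1\le i<j\le n}h(X_i,X_j).$$ Put $h_1(x):=\mathbb E[h(x,X_2)]$ and $\sigma_1^2:=\mathbb V[h_1(X_1)]$, where $\mathbb V$ denotes variance. $U_n(h)$ is non-degenerate if $\sigma_1^2>0$; centered means $\mathbb E[h(X_1,X_2)]=0$. A sequence of real random variables with laws $\mu_n$ satisfies the moderate deviation principle (formally a large deviation principle) with speed $s_n\to\infty$ and good rate function $I$ if the level sets $\{x: I(x)\le\alpha\}$ are compact for all $\alpha\in[0,\infty)$ and for all Borel sets $\Gamma$, $$-\inf_{x\in \mathrm{int}(\Gamma)}I(x)\le\liminf_{n\to\infty}\frac1{s_n}\log\mu_n(\Gamma)\le\limsup_{n\to\infty}\frac1{s_n}\log\mu_n(\Gamma)\le-\inf_{x\in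 \mathrm{cl}(\Gamma)}I(x).$$ *)

(* Defs.v *)
From HB Require Import structures.
From mathcomp Require Import all_boot all_order all_algebra finmap.
From mathcomp Require Import all_classical all_reals all_analysis
  measurable_realfun.

Set Implicit Arguments.
Unset Strict Implicit.
Unset Printing Implicit Defensive.

Import Order.TTheory GRing.Theory Num.Theory.
Import numFieldNormedType.Exports.

Local Open Scope classical_set_scope.
Local Open Scope ring_scope.

Section iid.
Context (R : realType) (d d' : measure_display).
Context (Omega : measurableType d) (T : measurableType d').
Context (P : probability Omega R).

Definition mutually_independent (X : nat -> {RV P >-> T}) : Prop :=
  forall (J : {fset nat}) (A : nat -> set T),
    (forall i, measurable (A i)) ->
    P (\bigcap_(i in [set` J]) X i @^-1` A i) =
    (\prod_(i <- J) P (X i @^-1` A i))%E.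

(* Only measurable sets are compared: a measure of the library also has a
   value at non-measurable sets, and that value has no meaning. *)
Definition identically_distributed (X : nat -> {RV P >-> T}) : Prop :=
  forall (i j : nat) (A : set T), measurable A ->
    distribution P (X i) A = distribution P (X j) A.

Definition iid (X : nat -> {RV P >-> T}) : Prop :=
  mutually_independent X /\ identically_distributed X.

End iid.

(* Sequences are indexed from 0: X 0, X 1, ... stand for X_1, X_2, ... *)
Section u_statistic.
Context (R : realType) (d d' : measure_display).
Context (Omega : measurableType d) (T : measurableType d').
Context (P : probability Omega R).
Variables (X : nat -> {RV P >-> T}) (h : {mfun (T * T)%type >-> R}).

(* The value is 0 for n < 2, where 'C(n, 2) = 0. *)
Definition Ustat (n : nat) (w : Omega) : R :=
  ('C(n, 2)%:R)^-1 * \sum_(i < n) \sum_(j < n | (i < j)%N) h (X i w, X j w).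

Let measurable_Ustat n : measurable_fun setT (Ustat n).
Proof.
apply: measurable_funM; first exact: measurable_cst.
apply: measurable_sum => i.
under eq_fun do rewrite -big_filter.
apply: measurable_sum => j.
apply: (measurableT_comp (measurable_funPT h)).
by apply: measurable_fun_pair; exact: measurable_funPT.
Qed.

HB.instance Definition _ n :=
  isMeasurableFun.Build _ _ _ _ (Ustat n) (measurable_Ustat n).

Definition h1 (x : T) : R := fine 'E_P[fun w => h (x, X 1%N w)]%E.

Definition sigma1_sqr : R := fine 'V_P[h1 \o X 0%N]%E.

Definition Ustat_nondegenerate : Prop := 0 < sigma1_sqr.

Definition Ustat_centered : Prop :=
  ('E_P[fun w => h (X 0%N w, X 1%N w)] = 0)%E.

(* n / a_n * U_n, since k \o* f is the function w |-> f w * k. *)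
Definition scaled_Ustat (a : nat -> R) (n : nat) : {RV P >-> R} :=
  (n%:R / a n) \o* Ustat n.

End u_statistic.

Section large_deviations.
Context (R : realType).
Local Open Scope ereal_scope.

Definition good_rate_function (I : R -> \bar R) : Prop :=
  forall alpha : R, (0 <= alpha)%R -> compact [set x | I x <= alpha%:E].

(* The inequality 0 <= I x is not a separate requirement: the lower bound for
   G = setT implies it. *)
Definition large_deviation_principle
    (mu : nat -> probability R R)
    (s : nat -> R) (I : R -> \bar R) : Prop :=
  [/\ s n @[n --> \oo] --> +oo%R,
      good_rate_function I
    & forall G : set R, measurable G ->
        [/\ - ereal_inf (I @` G°) <=
              limn_einf (fun n => (s n)^-1%:E * lne (mu n G)),
            limn_einf (fun n => (s n)^-1%:E * lne (mu n G)) <=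
              limn_esup (fun n => (s n)^-1%:E * lne (mu n G))
          & limn_esup (fun n => (s n)^-1%:E * lne (mu n G)) <=
              - ereal_inf (I @` closure G)]].

Definition satisfies_mdp (d : measure_display) (Omega : measurableType d)
    (P : probability Omega R) (Z : nat -> {RV P >-> R})
    (s : nat -> R) (I : R -> \bar R) : Prop :=
  large_deviation_principle (fun n => distribution P (Z n)) s I.

End large_deviations.

(* Main.v *)
(** The kernel splits as h(x,y) = h1(x) + h1(y) + h2(x,y) with h2 completely
    degenerate, so that (n/a_n) U_n = L_n + D_n with L_n = (2/a_n) sum_i h1(X_i)
    and D_n = (n/a_n) (n choose 2)^-1 sum_(i<j) h2(X_i,X_j).

    The Laplace transform of L_n is an n-th power, and the second order
    expansion of its base gives
    log E exp(s_n l L_n) = s_n (2 l^2 sigma_1^2 + o(1)).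

    D_n is exponentially negligible: log E exp(s_n t D_n) = o(s_n) for every t.
    Write M = sum_j xi_j with xi_j = sum_(i<j) h2(X_i,X_j) and let V_j be the
    variance of xi_j given X_i for i < j.  For small c n,
    exp(2cM - 4c^2 sum_j V_j) is a supermartingale, hence
    E exp(cM) <= (1 + E exp(4c^2 sum_j V_j)) / 2.  By Jensen, first over j and
    then over the last variable, the remaining mean reduces to
    E exp(4c^2 n (sum_(i<j) h2(X_i,y))^2) for fixed y, which degeneracy in the
    other variable bounds by 2 exp(O(c^4 n^5)); here c is of order a_n/n^2.

    Chernoff bounds yield the upper bound.  For the lower bound at x the
    indicator of |Z - x| < delta is bounded below by
    exp(- s_n (l x + |l| delta)) exp(s_n l Z), l = x / (4 sigma_1^2), minus two
    exponentials with the slope l shifted by +t and -t; these are of smaller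
    exponential order. *)

Require Import Defs.
From mathcomp Require Import all_boot all_order all_algebra finmap.
From mathcomp Require Import all_classical all_reals all_analysis
  measurable_realfun.
From mathcomp Require Import ring lra.

Set Implicit Arguments.
Unset Strict Implicit.
Unset Printing Implicit Defensive.

Import Order.TTheory GRing.Theory Num.Theory.
Import numFieldNormedType.Exports.

Local Open Scope classical_set_scope.
Local Open Scope ring_scope.

(** * Bounded measurable functions and their means *)

Section bounded_measurable.
Context {R : realType} {d} {S : measurableType d}.
Implicit Types f g : S -> R.

(** This class is closed under sums, products, exponentials and sections, and its members are
    integrable for every probability measure. All means below are thus real numbers, and no
    integrability condition recurs. *)
Definition bounded_measurable f : Prop :=
  measurable_fun setT f /\ exists M : R, forall x, `|f x| <= M.

Lemma bm_cst (r : R) : bounded_measurable (fun=> r).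
Proof. by split; [exact: measurable_cst|exists `|r|]. Qed.

Lemma bmD f g : bounded_measurable f -> bounded_measurable g ->
  bounded_measurable (fun x => f x + g x).
Proof.
move=> [mf [M Mf]] [mg [N Ng]]; split; first exact: measurable_funD.
by exists (M + N) => x; rewrite (le_trans (ler_normD _ _))// lerD.
Qed.

Lemma bmM f g : bounded_measurable f -> bounded_measurable g ->
  bounded_measurable (fun x => f x * g x).
Proof.
move=> [mf [M Mf]] [mg [N Ng]]; split; first exact: measurable_funM.
by exists (M * N) => x; rewrite normrM ler_pM.
Qed.

Lemma bmZ (r : R) f : bounded_measurable f ->
  bounded_measurable (fun x => r * f x).
Proof. by move=> bf; apply: bmM => //; exact: bm_cst. Qed.

Lemma bmN f : bounded_measurable f -> bounded_measurable (fun x => - f x).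
Proof.
move=> [mf [M Mf]]; split; first exact: measurableT_comp.
by exists M => x; rewrite normrN.
Qed.

Lemma bmB f g : bounded_measurable f -> bounded_measurable g ->
  bounded_measurable (fun x => f x - g x).
Proof. by move=> bf bg; apply: bmD => //; exact: bmN. Qed.

Lemma bmX f n : bounded_measurable f -> bounded_measurable (fun x => f x ^+ n).
Proof.
move=> bf; elim: n => [|n IH]; first exact: bm_cst.
by under eq_fun do rewrite exprS; exact: bmM.
Qed.

Lemma bm_norm f : bounded_measurable f -> bounded_measurable (fun x => `|f x|).
Proof.
move=> [mf [M Mf]]; split; first exact: measurableT_comp.
by exists M => x; rewrite normr_id.
Qed.

Lemma bm_expR f : bounded_measurable f ->
  bounded_measurable (fun x => expR (f x)).
Proof.
move=> [mf [M Mf]]; split; first exact: measurableT_comp.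
exists (expR M) => x; rewrite ger0_norm ?expR_ge0// ler_expR.
by rewrite (le_trans (ler_norm _)).
Qed.

Lemma bm_sum (I : Type) (s : seq I) (F : I -> S -> R) :
  (forall i, bounded_measurable (F i)) ->
  bounded_measurable (fun x => \sum_(i <- s) F i x).
Proof.
move=> bF; elim: s => [|i s IH].
  by under eq_fun do rewrite big_nil; exact: bm_cst.
by under eq_fun do rewrite big_cons; exact: bmD.
Qed.

Lemma bm_indic (A : set S) : measurable A ->
  bounded_measurable (\1_A : S -> R).
Proof.
move=> mA; split; first exact: measurable_indic.
by exists 1 => x; rewrite indicE ger0_norm ?ler0n// lern1 leq_b1.
Qed.

End bounded_measurable.

Lemma bm_comp {R : realType} {d d'} {S : measurableType d}
    {S' : measurableType d'} (f : S' -> R) (g : S -> S') :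
  bounded_measurable f -> measurable_fun setT g ->
  bounded_measurable (fun x => f (g x)).
Proof.
move=> [mf [M Mf]] mg; split; last by exists M.
exact: measurableT_comp.
Qed.

Section mean.
Context {R : realType} {d} {S : measurableType d} (P : probability S R).
Implicit Types f g : S -> R.

Definition mean f : R := \int[P]_w f w.

Lemma bm_integrable f : bounded_measurable f -> P.-integrable setT (EFin \o f).
Proof.
move=> [mf [M Mf]]; apply: measurable_bounded_integrable => //.
- by rewrite /= probability_setT ltry.
- by exists M; split; [exact: num_real|move=> y /ltW My x _;
  exact: le_trans My].
Qed.

Lemma EFin_mean f : bounded_measurable f ->
  (\int[P]_w (f w)%:E)%E = (mean f)%:E.
Proof.
by move=> bf; rewrite /mean /Rintegral fineK// integrable_fin_num//;
  exact: bm_integrable.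
Qed.

Lemma eq_mean f g : f =1 g -> mean f = mean g.
Proof. by move=> fg; apply: eq_Rintegral => x _; exact: fg. Qed.

Lemma mean_cst (r : R) : mean (fun=> r) = r.
Proof.
by rewrite /mean Rintegral_cst//= probability_setT mulr1.
Qed.

Lemma meanD f g : bounded_measurable f -> bounded_measurable g ->
  mean (fun x => f x + g x) = mean f + mean g.
Proof. by move=> bf bg; rewrite /mean RintegralD//; exact: bm_integrable. Qed.

Lemma meanB f g : bounded_measurable f -> bounded_measurable g ->
  mean (fun x => f x - g x) = mean f - mean g.
Proof. by move=> bf bg; rewrite /mean RintegralB//; exact: bm_integrable. Qed.

Lemma meanZ (r : R) f : bounded_measurable f ->
  mean (fun x => r * f x) = r * mean f.
Proof. by move=> bf; rewrite /mean RintegralZl//; exact: bm_integrable. Qed.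

Lemma mean_sum (I : Type) (s : seq I) (F : I -> S -> R) :
  (forall i, bounded_measurable (F i)) ->
  mean (fun x => \sum_(i <- s) F i x) = \sum_(i <- s) mean (F i).
Proof.
move=> bF; elim: s => [|i s IH].
  by under eq_mean do rewrite big_nil; rewrite big_nil mean_cst.
under eq_mean do rewrite big_cons.
by rewrite big_cons meanD ?IH//; exact: bm_sum.
Qed.

Lemma le_mean f g : bounded_measurable f -> bounded_measurable g ->
  (forall x, f x <= g x) -> mean f <= mean g.
Proof. by move=> bf bg fg; rewrite /mean le_Rintegral//;
  exact: bm_integrable. Qed.

Lemma mean_ge0 f : (forall x, 0 <= f x) -> 0 <= mean f.
Proof. by move=> f0; exact: Rintegral_ge0. Qed.

Lemma norm_mean_le f M : bounded_measurable f -> (forall x, `|f x| <= M) ->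
  `|mean f| <= M.
Proof.
move=> bf fM; rewrite /mean.
rewrite (le_trans (le_normr_Rintegral _ (bm_integrable bf)))//.
rewrite -[leRHS]mean_cst; apply: le_mean => //; [exact: bm_norm|exact: bm_cst].
Qed.

Lemma mean_indic (A : set S) : measurable A -> mean (\1_A) = fine (P A).
Proof.
by move=> mA; rewrite /mean /Rintegral integral_indic// setIT.
Qed.

(* Integrate the tangent line of exp at the mean. *)
Lemma expR_mean_le f : bounded_measurable f ->
  expR (mean f) <= mean (fun x => expR (f x)).
Proof.
move=> bf; set m := mean f.
suff : mean (fun x => expR m * (1 + (f x - m))) <= mean (fun x => expR (f x)).
  rewrite meanZ; last by do 2?[apply: bmD]; do ?exact: bm_cst.
  rewrite meanD ?meanB//; do ?[exact: bm_cst|exact: bmB (bm_cst _)].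
  by rewrite !mean_cst -/m subrr addr0 mulr1.
apply: le_mean; [|exact: bm_expR|].
  by apply: bmZ; apply: bmD; [exact: bm_cst|exact: bmB (bm_cst _)].
move=> x; have /(ler_wpM2l (expR_ge0 m)) := expR_ge1Dx (f x - m).
by rewrite -expRD subrKC.
Qed.

End mean.

Section sections.
Context {R : realType} {d1 d2 : measure_display}.
Context {S1 : measurableType d1} {S2 : measurableType d2}.
Variables (P2 : probability S2 R) (F : S1 * S2 -> R).
Hypothesis bF : bounded_measurable F.

Lemma bm_pair1 x : bounded_measurable (fun y => F (x, y)).
Proof. by apply: bm_comp bF _; exact: pair1_measurable. Qed.

Lemma bm_pair2 y : bounded_measurable (fun x => F (x, y)).
Proof. by apply: bm_comp bF _; exact: pair2_measurable. Qed.

Lemma bm_mean_section :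
  bounded_measurable (fun x => mean P2 (fun y => F (x, y))).
Proof.
split.
  (* The library asks for integrability on the product, hence for some measure
     on [S1]. *)
  have := measurable_fubini_F
    (@bm_integrable _ _ _ (dirac (point : S1) \x P2)%E F bF).
  rewrite /fubini_F/= => mF.
  apply/measurable_EFinP; rewrite (_ : _ \o _ = fubini_F P2 (EFin \o F))//.
  by apply/funext => x; rewrite /= /fubini_F -EFin_mean//; exact: bm_pair1.
have [_ [M MF]] := bF; exists M => x.
by apply: norm_mean_le => //; exact: bm_pair1.
Qed.

End sections.

Section fubini.
Context {R : realType} {d1 d2 : measure_display}.
Context {S1 : measurableType d1} {S2 : measurableType d2}.
Variables (P1 : probability S1 R) (P2 : probability S2 R) (F : S1 * S2 -> R).
Hypothesis bF : bounded_measurable F.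

Lemma mean_prod :
  mean (P1 \x P2)%E F = mean P1 (fun x => mean P2 (fun y => F (x, y))).
Proof.
apply: EFin_inj; rewrite -!EFin_mean//; last exact: bm_mean_section.
have <- := integral12_prod_meas1 (bm_integrable (P1 \x P2)%E bF).
by apply: eq_integral => x _; rewrite /fubini_F EFin_mean//; exact: bm_pair1.
Qed.

Lemma mean_fubini : mean P1 (fun x => mean P2 (fun y => F (x, y))) =
  mean P2 (fun y => mean P1 (fun x => F (x, y))).
Proof.
have bF' : bounded_measurable (fun z => F (z.2, z.1)).
  apply: (bm_comp bF); apply: measurable_fun_pair.
    exact: measurable_snd.
  exact: measurable_fst.
apply: EFin_inj; rewrite -!EFin_mean; last 2 first.
- exact: (bm_mean_section P1 bF').
- exact: (bm_mean_section P2 bF).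
transitivity (\int[P1]_x \int[P2]_y (F (x, y))%:E)%E.
  by apply: eq_integral => x _; rewrite EFin_mean//; exact: bm_pair1.
rewrite (Fubini (bm_integrable (P1 \x P2)%E bF)).
by apply: eq_integral => y _; rewrite EFin_mean//; exact: bm_pair2.
Qed.

End fubini.

(** * Independence of the past *)

Lemma mean_distribution {R : realType} {d d'} {S : measurableType d}
    {S' : measurableType d'} (P : probability S R) (Y : {RV P >-> S'})
    (f : S' -> R) : bounded_measurable f ->
  mean (distribution P Y) f = mean P (fun w => f (Y w)).
Proof.
move=> bf; apply: EFin_inj; rewrite -!EFin_mean//; last first.
  by apply: bm_comp bf _; exact: measurable_funPT.
rewrite integral_distribution//.
  by apply/measurable_EFinP; case: bf.
by apply: (@bm_integrable _ _ _ P (fun w => f (Y w))); apply: bm_comp bf _;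
  exact: measurable_funPT.
Qed.

Lemma eq_measure_mean {R : realType} {d} {S : measurableType d}
    (P Q : probability S R) (f : S -> R) :
  (forall A, measurable A -> P A = Q A) -> mean P f = mean Q f.
Proof.
move=> PQ; congr fine; apply: eq_measure_integral => A mA _; exact: PQ.
Qed.

(** The law of (Y, Z) agrees with the product of the laws on rectangles, hence everywhere, and
    Fubini applies. [Y] is a plain function so that it can be the identity into a coarser measurable
    space. *)
Lemma mean_indep {R : realType} {d d1 d2} {S : measurableType d}
    {S1 : measurableType d1} {S2 : measurableType d2} (P : probability S R)
    (Y : S -> S1) (Z : {RV P >-> S2}) (F : S1 * S2 -> R) :
  measurable_fun setT Y ->
  (forall A B, measurable A -> measurable B ->
     P (Y @^-1` A `&` Z @^-1` B) = (P (Y @^-1` A) * P (Z @^-1` B))%E) ->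
  bounded_measurable F ->
  mean P (fun w => F (Y w, Z w)) =
    mean P (fun w => mean P (fun w' => F (Y w, Z w'))).
Proof.
move=> mY YZ bF.
pose Y' : {RV P >-> S1} := mfun_Sub (mem_set mY).
have mYZ : measurable_fun setT (fun w => (Y w, Z w)).
  by apply: measurable_fun_pair => //; exact: measurable_funPT.
pose YZ' : {RV P >-> (S1 * S2)%type} := mfun_Sub (mem_set mYZ).
rewrite -[LHS]/(mean P (fun w => F (YZ' w))) -mean_distribution//.
transitivity (mean (distribution P Y' \x distribution P Z)%E F).
  apply: eq_measure_mean => A mA; apply/esym.
  by apply: product_measure_unique => // B C mB mC; exact: YZ.
rewrite mean_prod// mean_distribution; last first.
  exact: (bm_mean_section (distribution P Z) bF).
by apply: eq_mean => w; rewrite mean_distribution//; exact: bm_pair1.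
Qed.

Section past.
Context (R : realType) (d d' : measure_display).
Context (Omega : measurableType d) (T : measurableType d').
Context (P : probability Omega R) (X : nat -> {RV P >-> T}).

Definition past_cylinder n : set (set Omega) :=
  [set C | exists2 A : nat -> set T, (forall i, measurable (A i)) &
    C = \bigcap_(i in `I_n) X i @^-1` A i].

(** [Omega] with the sigma-algebra generated by the [X i], i < n. As a measurable space of its own
    it makes adaptedness plain measurability and conditioning an instance of Fubini. *)
Definition past n : measurableType _ := g_sigma_algebraType (past_cylinder n).

Lemma past_cylinder_measurable n : past_cylinder n `<=` measurable.
Proof.
move=> _ [A mA ->]; apply: bigcap_measurableType => i _.
by rewrite -[X in measurable X]setTI; exact: measurable_funPT.
Qed.

Lemma measurable_past n (A : set Omega) :
  measurable (A : set (past n)) -> measurable A.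
Proof.
by move: A; apply: smallest_sub;
  [exact: sigma_algebra_measurable|exact: past_cylinder_measurable].
Qed.

Lemma measurable_fun_past n i : (i < n)%N ->
  measurable_fun setT (X i : past n -> T).
Proof.
move=> i_n _ B mB; rewrite setTI; apply: sub_sigma_algebra.
exists (fun j => if j == i then B else setT); first by move=> j; case: ifP.
apply/seteqP; split => [w XB j _ /=|w]; first by case: eqP => // ->.
by move=> /(_ i i_n) /=; rewrite eqxx.
Qed.

Hypothesis X_indep : mutually_independent X.

Lemma past_cylinder_indep n A B : past_cylinder n A -> measurable B ->
  P (A `&` X n @^-1` B) = (P A * P (X n @^-1` B))%E.
Proof.
move=> [C mC ->] mB.
pose J : {fset nat} := [fset i | i in iota 0 n]%fset.
have JE : [set` J] = `I_n.
  by apply/seteqP; split => i /=; rewrite !inE /= mem_iota add0n.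
have nJ : n \notin J by rewrite !inE /= mem_iota add0n ltnn.
(* A single family of sets, so that mutual independence over the first n + 1 indices yields the
   factor at [n]. *)
pose D i := if i == n then B else C i.
have mD i : measurable (D i) by rewrite /D; case: ifP.
have DC i : i \in J -> D i = C i.
  by rewrite /D; case: eqP nJ => // -> /negP.
have := X_indep (n |` J)%fset mD; rewrite big_fsetU1//= {2}/D eqxx.
rewrite set_fsetU set_fset1 bigcap_setU bigcap_set1 {1}/D eqxx JE.
rewrite (eq_bigr (fun i => P (X i @^-1` D i)))//.
rewrite (_ : \bigcap_(i in `I_n) X i @^-1` D i =
  \bigcap_(i in `I_n) X i @^-1` C i); last first.
  by apply: eq_bigcapr => i; rewrite -JE => /DC ->.
rewrite setIC => ->; rewrite muleC; congr (_ * _)%E.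
rewrite -JE X_indep//; apply: eq_big_seq => i /DC -> //.
Qed.

(** Both sides are finite measures in [A], namely a restriction and a multiple of [P]; they agree on
    the cylinders, which form a generating pi-system. *)
Lemma past_indep n (A : set Omega) (B : set T) :
  measurable (A : set (past n)) -> measurable B ->
  P (A `&` X n @^-1` B) = (P A * P (X n @^-1` B))%E.
Proof.
move=> mA mB.
have mXB : measurable (X n @^-1` B).
  by rewrite -[X in measurable X]setTI; exact: measurable_funPT.
have rge0 : 0 <= fine (P (X n @^-1` B)) by rewrite fine_ge0.
pose m2 : {measure set Omega -> \bar R} := mscale (NngNum rge0) P.
have m2E C : m2 C = (P C * P (X n @^-1` B))%E.
  rewrite -[LHS]/((fine (P (X n @^-1` B)))%:E * P C)%E.
  by rewrite fineK ?fin_num_measure// muleC.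
rewrite -m2E.
apply: (g_sigma_algebra_measure_unique (past_cylinder n)
  (@past_cylinder_measurable n) (fun=> setT) _ _ (mrestr P mXB)) => //.
- move=> _; exists (fun=> setT) => //; apply/seteqP; split => // w _ i _ //.
- by apply/seteqP; split => // w _; exists 0%N.
- move=> _ _ [C mC ->] [D mD ->]; exists (fun i => C i `&` D i).
    by move=> i; exact: measurableI.
  by rewrite -bigcapI; apply: eq_bigcapr => i _; rewrite preimage_setI.
- by move=> C /past_cylinder_indep H; rewrite m2E -H.
- move=> _; apply: le_lt_trans (ltry 1).
  exact: (probability_le1 P (measurableI _ _ measurableT mXB)).
Qed.

(** This replaces conditional expectation: [X n] is averaged over [w'] while everything that depends
    on the past stays frozen at [w]. *)
Lemma mean_past n (F : past n * T -> R) : bounded_measurable F ->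
  mean P (fun w => F (w, X n w)) =
  mean P (fun w => mean P (fun w' => F (w, X n w'))).
Proof.
move=> bF; apply: (@mean_indep _ _ _ _ _ (past n) _ P id) => //.
  by move=> _ A mA; rewrite setTI; exact: measurable_past mA.
by move=> A B mA mB; exact: past_indep.
Qed.

Lemma bm_past n (f : Omega -> R) :
  @bounded_measurable _ _ (past n) f -> bounded_measurable f.
Proof.
move=> [mf bf]; split => // _ B mB; apply: measurable_past; exact: mf.
Qed.

Lemma past_widen n m (A : set Omega) : (n <= m)%N ->
  measurable (A : set (past n)) -> measurable (A : set (past m)).
Proof.
move=> nm; move: A; apply: smallest_sub; first exact: sigma_algebra_measurable.
move=> _ [A mA ->]; apply: sub_sigma_algebra.
exists (fun i => if (i < n)%N then A i else setT); first by move=> i; case: ifP.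
apply/seteqP; split => w Aw i /= im; last first.
  by have /= := Aw i (leq_trans im nm); rewrite im.
by case: ifPn => // i_n; exact: Aw.
Qed.

Lemma bm_past_widen n m (f : Omega -> R) : (n <= m)%N ->
  @bounded_measurable _ _ (past n) f -> @bounded_measurable _ _ (past m) f.
Proof.
move=> nm [mf bf]; split => // _ B mB; apply: (past_widen nm); exact: mf.
Qed.

Hypothesis X_id : identically_distributed X.

Lemma mean_iid i j (f : T -> R) : bounded_measurable f ->
  mean P (fun w => f (X i w)) = mean P (fun w => f (X j w)).
Proof.
move=> bf; rewrite -!mean_distribution//.
by apply: eq_measure_mean => A mA; exact: X_id.
Qed.

End past.

(** * Expansion of the exponential and of Laplace transforms *)

Section expR_taylor.
Context {R : realType}.
Implicit Types x y : R.

Lemma derive_ge0_ge0 (f df : R -> R) (b : R) :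
  (forall x, is_derive x (1 : R) f (df x)) -> f 0 = 0 ->
  (forall x, 0 <= x <= b -> 0 <= df x) ->
  forall x, 0 <= x <= b -> 0 <= f x.
Proof.
move=> fdf f0 df0 x /andP[x0 xb].
have cf : {within `[0, x], continuous f}.
  apply: continuous_subspaceT => y; apply: differentiable_continuous.
  by apply/derivable1_diffP; have [] := fdf y.
have [c] := MVT_segment x0 (fun y _ => fdf y) cf.
rewrite in_itv/= f0 !subr0 => /andP[c0 cx] ->.
by rewrite mulr_ge0// df0// c0 (le_trans cx).
Qed.

(** From exp(-y) >= 1 - y one gets exp(y) <= 1/(1 - y), and 1/(1 - y) <= 1 + 2y on this interval. *)
Lemma expR_le_half y : 0 <= y <= 1 / 2 -> expR y <= 1 + 2 * y.
Proof.
move=> /andP[y0 y1]; have := expR_ge1Dx (- y); rewrite expRN => h.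
have e0 := expR_gt0 y; have : expR y * (1 - y) <= 1.
  by rewrite -ler_pdivlMl// mulr1.
nra.
Qed.

(** Differentiate until a linear bound on exp remains: once for the lower bound, which leaves exp(x)
    >= 1 + x, and twice for the upper one, which leaves exp(x) <= 1 + 6x. *)
Lemma expR_taylor2_pos y : 0 <= y <= 1 / 2 ->
  1 + y + y ^+ 2 / 2 <= expR y <= 1 + y + y ^+ 2 / 2 + y ^+ 3.
Proof.
move=> yb; apply/andP; split; rewrite -subr_ge0.
  apply: (@derive_ge0_ge0 (fun y => expR y - (1 + y + y ^+ 2 / 2))
    (fun y => expR y - (1 + y)) (1 / 2)) yb.
  - move=> x; apply: is_derive_eq; rewrite /GRing.scale/=; by field.
  - by rewrite /= expR0; ring.
  - by move=> x _; rewrite subr_ge0; exact: expR_ge1Dx.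
apply: (@derive_ge0_ge0 (fun y => 1 + y + y ^+ 2 / 2 + y ^+ 3 - expR y)
    (fun y => 1 + y + 3 * y ^+ 2 - expR y) (1 / 2)) yb.
- move=> x; apply: is_derive_eq; rewrite /GRing.scale/=; by field.
- by rewrite /= expR0; ring.
apply: (@derive_ge0_ge0 _ (fun y => 1 + 6 * y - expR y)).
- move=> x; apply: is_derive_eq; rewrite /GRing.scale/=; by field.
- by rewrite /= expR0; ring.
by move=> x xb; have := expR_le_half xb; lra.
Qed.

Lemma expR_taylor2_neg y : 0 <= y <= 1 / 2 ->
  1 - y + y ^+ 2 / 2 - y ^+ 3 <= expR (- y) <= 1 - y + y ^+ 2 / 2.
Proof.
move=> yb; apply/andP; split; rewrite -subr_ge0; last first.
  apply: (@derive_ge0_ge0 (fun y => 1 - y + y ^+ 2 / 2 - expR (- y))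
    (fun y => - 1 + y + expR (- y)) (1 / 2)) yb.
  - move=> x; apply: is_derive_eq; rewrite /GRing.scale/=; by field.
  - by rewrite /= oppr0 expR0; ring.
  - by move=> x _; have := expR_ge1Dx (- x); lra.
apply: (@derive_ge0_ge0 (fun y => expR (- y) - (1 - y + y ^+ 2 / 2 - y ^+ 3))
    (fun y => - expR (- y) + 1 - y + 3 * y ^+ 2) (1 / 2)) yb.
- move=> x; apply: is_derive_eq; rewrite /GRing.scale/=; by field.
- by rewrite /= oppr0 expR0; ring.
apply: (@derive_ge0_ge0 _ (fun y => expR (- y) - 1 + 6 * y)).
- move=> x; apply: is_derive_eq; rewrite /GRing.scale/=; by field.
- by rewrite /= oppr0 expR0; ring.
by move=> x xb; have := expR_ge1Dx (- x); lra.
Qed.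

Lemma expR_taylor2 y : `|y| <= 1 / 2 ->
  `|expR y - (1 + y + y ^+ 2 / 2)| <= `|y| ^+ 3.
Proof.
case: (ger0P y) => y0 yb.
  have /expR_taylor2_pos/andP[h1 h2] : 0 <= y <= 1 / 2 by rewrite y0.
  by have := exprn_ge0 3 y0; rewrite ler_norml; lra.
have Ny0 : 0 <= - y by lra.
have /expR_taylor2_neg/andP[] : 0 <= - y <= 1 / 2 by rewrite Ny0.
rewrite opprK => h1 h2.
by have := exprn_ge0 3 Ny0; rewrite ler_norml; move: h1 h2; rewrite sqrrN; lra.
Qed.

Lemma expR_le_sqr y : `|y| <= 1 / 2 -> expR y <= 1 + y + y ^+ 2.
Proof.
move=> yb; have := expR_taylor2 yb; rewrite ler_norml => /andP[_].
have y0 := normr_ge0 y; have : `|y| ^+ 3 <= `|y| ^+ 2 / 2 by nra.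
by rewrite (real_normK (num_real y)); lra.
Qed.

End expR_taylor.

(** * Laplace transforms of centered bounded functions near zero *)

Section centered_mgf.
Context {R : realType} {d} {S : measurableType d} (P : probability S R).
Variables (f : S -> R) (K : R).
Hypotheses (bf : bounded_measurable f) (fK : forall x, `|f x| <= K).
Hypothesis f0 : mean P f = 0.

Let bcf (c : R) : bounded_measurable (fun x => c * f x).
Proof. exact: bmZ. Qed.

Let K0 : 0 <= K. Proof. exact: le_trans (fK point). Qed.

(** Centering kills the linear term of [expR_le_sqr], and 1 + x <= exp(x). Keeping the second moment
    instead of K^2 lets the conditional variance appear in the supermartingale below. *)
Lemma centered_mgf_le (c : R) : `|c| * K <= 1 / 2 ->
  mean P (fun x => expR (c * f x)) <=
    expR (c ^+ 2 * mean P (fun x => f x ^+ 2)).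
Proof.
move=> cK; have bf2 := bmX 2 bf.
have bb : bounded_measurable (fun x => 1 + c * f x).
  by apply: bmD => //; exact: bm_cst.
apply: (@le_trans _ _ (mean P (fun x => (1 + c * f x) + c ^+ 2 * f x ^+ 2))).
  apply: le_mean; [exact: bm_expR|apply: bmD => //; exact: bmZ|] => x.
  rewrite -exprMn; apply: expR_le_sqr; rewrite normrM (le_trans _ cK)//.
  exact: ler_wpM2l.
rewrite meanD//; last exact: bmZ.
rewrite meanD ?mean_cst ?meanZ ?f0 ?mulr0 ?addr0//; last exact: bm_cst.
exact: expR_ge1Dx.
Qed.

Lemma centered_mgf_taylor (c : R) : `|c| * K <= 1 / 2 ->
  `|mean P (fun x => expR (c * f x)) -
    (1 + c ^+ 2 * mean P (fun x => f x ^+ 2) / 2)|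
  <= (`|c| * K) ^+ 3.
Proof.
move=> cK; have bf2 := bmX 2 bf; have be := bm_expR (bcf c).
have bb : bounded_measurable (fun x => 1 + c * f x).
  by apply: bmD => //; exact: bm_cst.
have bt : bounded_measurable (fun x => (1 + c * f x) + c ^+ 2 / 2 * f x ^+ 2).
  by apply: bmD => //; exact: bmZ.
rewrite (_ : _ - _ = mean P (fun x => expR (c * f x) -
    ((1 + c * f x) + c ^+ 2 / 2 * f x ^+ 2))); last first.
  rewrite meanB// meanD//; last exact: bmZ.
  rewrite meanD ?mean_cst ?meanZ ?f0 ?mulr0 ?addr0//; last exact: bm_cst.
  by ring.
apply: norm_mean_le; first exact: bmB.
move=> x; have cfK : `|c * f x| <= `|c| * K by rewrite normrM ler_wpM2l.
apply: (@le_trans _ _ (`|c * f x| ^+ 3)).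
  have := expR_taylor2 (le_trans cfK cK).
  by rewrite (_ : (c * f x) ^+ 2 / 2 = c ^+ 2 / 2 * f x ^+ 2)//; ring.
by rewrite lerXn2r// nnegrE// mulr_ge0.
Qed.

Lemma centered_mgf_asymp (e : R) : 0 < e ->
  let v := mean P (fun x => f x ^+ 2) in
  exists2 eta, 0 < eta & forall c : R, `|c| <= eta ->
  expR (c ^+ 2 * (v / 2 - e)) <= mean P (fun x => expR (c * f x)) <=
  expR (c ^+ 2 * (v / 2 + e)).
Proof.
move=> e0 v; pose u := v / 2 - e.
(* [A] dominates every constant met below, so the single condition |c| A <= m makes all error terms
   small. *)
pose A := 1 + K + K ^+ 3 + u ^+ 2 + `|u|.
have K3 : 0 <= K ^+ 3 by exact: exprn_ge0.
have u2 : 0 <= u ^+ 2 by exact: sqr_ge0.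
have u0 : 0 <= `|u| by [].
have K0' := K0.
have A0 : 1 <= A by rewrite /A; lra.
pose m : R := Num.min (1 / 2) (e / 2).
have m0 : 0 < m by rewrite /m lt_min !divr_gt0.
have m1 : m <= 1 / 2 by rewrite /m ge_min lexx.
have m2 : m <= e / 2 by rewrite /m ge_min lexx orbT.
exists (m / A) => [|c]; first by rewrite divr_gt0//; lra.
rewrite ler_pdivlMr; last lra.
move=> cA; have c0 := normr_ge0 c.
have cb (B : R) : B <= A -> `|c| * B <= m.
  by move=> BA; apply: le_trans cA; exact: ler_wpM2l.
have c1 : `|c| <= 1 / 2 by have := cb 1 A0; lra.
have cK : `|c| * K <= 1 / 2 by apply: le_trans (cb _ _) m1; rewrite /A; lra.
have cK3 : `|c| * K ^+ 3 <= e / 2.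
  by apply: le_trans (cb _ _) m2; rewrite /A; lra.
have cu2 : `|c| * u ^+ 2 <= e / 2.
  by apply: le_trans (cb _ _) m2; rewrite /A; lra.
have cu : `|c| * `|u| <= 1 / 2.
  by apply: le_trans (cb _ _) m1; rewrite /A; lra.
have cc : c ^+ 2 = `|c| ^+ 2 by rewrite real_normK ?num_real.
have := centered_mgf_taylor cK; rewrite -/v ler_norml.
rewrite exprMn => /andP[h1 h2]; apply/andP; split.
  (* The gap c^2 e between c^2 v/2 and c^2 u has to absorb both the quadratic term (c^2 u)^2 of exp
     and the cubic Taylor remainder. *)
  have cu' : `|c ^+ 2 * u| <= 1 / 2 by rewrite normrM normrX; nra.
  have := expR_le_sqr cu'; rewrite -/u.
  suff : (c ^+ 2 * u) ^+ 2 + `|c| ^+ 3 * K ^+ 3 <= c ^+ 2 * e.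
    by rewrite /u; move: h1; lra.
  rewrite (_ : _ + _ = c ^+ 2 * (`|c| * (`|c| * u ^+ 2) + `|c| * K ^+ 3)).
    by apply: ler_wpM2l; [exact: sqr_ge0|nra].
  by rewrite cc; ring.
apply: le_trans (expR_ge1Dx _).
suff : `|c| ^+ 3 * K ^+ 3 <= c ^+ 2 * e by lra.
rewrite (_ : `|c| ^+ 3 * K ^+ 3 = c ^+ 2 * (`|c| * K ^+ 3));
  last by rewrite cc; ring.
by apply: ler_wpM2l; [exact: sqr_ge0|lra].
Qed.

End centered_mgf.

(** * Exponential moments of degenerate sums *)

Section iid_sums.
Context (R : realType) (d d' : measure_display).
Context (Omega : measurableType d) (T : measurableType d').
Context (P : probability Omega R) (X : nat -> {RV P >-> T}).
Hypothesis X_iid : iid X.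

Let X_indep : mutually_independent X. Proof. by case: X_iid. Qed.
Let X_id : identically_distributed X. Proof. by case: X_iid. Qed.

Lemma bm_past_term n i (f : T -> R) : (i < n)%N -> bounded_measurable f ->
  @bounded_measurable _ _ (past X n) (fun w => f (X i w)).
Proof. by move=> i_n bf; apply: bm_comp bf _; exact: measurable_fun_past. Qed.

Lemma bm_past_sum n (f : T -> R) : bounded_measurable f ->
  @bounded_measurable _ _ (past X n) (fun w => \sum_(i < n) f (X i w)).
Proof. by move=> bf; apply: bm_sum => i; exact: bm_past_term. Qed.

(** Induction on n: [mean_past] splits off the last variable, whose factor is the same for every
    index. *)
Lemma mgf_iid_sum n (f : T -> R) : bounded_measurable f ->
  mean P (fun w => expR (\sum_(i < n) f (X i w))) =
  mean P (fun w => expR (f (X 0%N w))) ^+ n.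
Proof.
move=> bf; elim: n => [|n IH].
  by under eq_mean do rewrite big_ord0; rewrite expR0 mean_cst.
rewrite exprSr -IH.
pose F (z : past X n * T) := expR (\sum_(i < n) f (X i z.1)) * expR (f z.2).
have bF : bounded_measurable F.
  apply: bmM; last by apply: bm_comp (bm_expR bf) _; exact: measurable_snd.
  apply: (bm_comp (bm_expR (bm_past_sum n bf))); exact: measurable_fst.
transitivity (mean P (fun w => F (w, X n w))).
  by apply: eq_mean => w; rewrite big_ord_recr/= expRD.
rewrite mean_past//.
under eq_mean => w.
  rewrite /F/= meanZ; last exact: bm_comp (bm_expR bf) (measurable_funPT _).
  rewrite (mean_iid X_id n 0%N (bm_expR bf)) mulrC.
  over.
rewrite meanZ; first by rewrite [LHS]mulrC.
by apply: bm_expR; exact: bm_past (bm_past_sum n bf).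
Qed.

Lemma iid_sum_mgf_le n (f : T -> R) (K c : R) : bounded_measurable f ->
  (forall x, `|f x| <= K) -> mean P (fun w => f (X 0%N w)) = 0 ->
  `|c| * K <= 1 / 2 ->
  mean P (fun w => expR (c * \sum_(i < n) f (X i w))) <=
  expR (n%:R * (c * K) ^+ 2).
Proof.
move=> bf fK f0 cK.
under eq_mean do rewrite mulr_sumr.
rewrite (@mgf_iid_sum n (fun x => c * f x)) ?expRM_natl; last exact: bmZ.
have bfX : bounded_measurable (fun w => f (X 0%N w)).
  by apply: bm_comp bf _; exact: measurable_funPT.
rewrite lerXn2r ?nnegrE ?expR_ge0//; first by apply: mean_ge0 => w;
  exact: expR_ge0.
apply: (le_trans (centered_mgf_le bfX _ f0 cK)) => //.
rewrite ler_expR exprMn ler_wpM2l ?sqr_ge0//.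
rewrite -[leRHS](mean_cst P); apply: le_mean; [exact: bmX|exact: bm_cst|] => w.
by rewrite -real_normK ?num_real// lerXn2r ?nnegrE// (le_trans (normr_ge0 _)
  (fK (X 0%N w))).
Qed.

End iid_sums.

Section degenerate.
Context (R : realType) (d d' : measure_display).
Context (Omega : measurableType d) (T : measurableType d').
Context (P : probability Omega R) (X : nat -> {RV P >-> T}).
Hypothesis X_iid : iid X.
Variables (k : T * T -> R) (K : R).
Hypotheses (bk : bounded_measurable k) (kK : forall z, `|k z| <= K).
Hypothesis degenerate1 : forall x i, mean P (fun w => k (x, X i w)) = 0.
Hypothesis degenerate2 : forall y i, mean P (fun w => k (X i w, y)) = 0.

Let X_indep : mutually_independent X. Proof. by case: X_iid. Qed.
Let X_id : identically_distributed X. Proof. by case: X_iid. Qed.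

Let K_ge0 : 0 <= K. Proof. exact: le_trans (kK point). Qed.

(** The increment of [quad] at step [n] with the new variable replaced by a free argument [y]. For
    fixed [y] it is a sum of i.i.d. terms. *)
Let linear n (w : Omega) (y : T) : R := \sum_(i < n) k (X i w, y).

Let quad n (w : Omega) : R := \sum_(j < n) linear j w (X j w).

(* The conditional variance of [quad n.+1 - quad n] given the past. *)
Let cvar n (w : Omega) : R := mean P (fun w' => linear n w (X n w') ^+ 2).

Let linear_le n w y : `|linear n w y| <= n%:R * K.
Proof.
rewrite (le_trans (ler_norm_sum _ _ _))//.
apply: (@le_trans _ _ (\sum_(i < n) K)); first exact: ler_sum.
by rewrite sumr_const card_ord mulr_natl.
Qed.

Let bm_linear_past n :
  bounded_measurable (fun z : past X n * T => linear n z.1 z.2).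
Proof.
apply: bm_sum => i; apply: (bm_comp bk); apply: measurable_fun_pair.
  apply: (@measurableT_comp _ _ _ _ _ _ (X i : past X n -> T)).
    exact: measurable_fun_past.
  exact: measurable_fst.
exact: measurable_snd.
Qed.

Let bm_linear n (z : Omega) : bounded_measurable (linear n z).
Proof. exact: (bm_pair1 (bm_linear_past n) z). Qed.

Let bm_linear_full n :
  bounded_measurable (fun z : Omega * Omega => linear n z.1 (X n z.2)).
Proof.
apply: bm_sum => i; apply: (bm_comp bk); apply: measurable_fun_pair.
  by apply: (@measurableT_comp _ _ _ _ _ _ (X i)) => //; exact: measurable_fst.
by apply: (@measurableT_comp _ _ _ _ _ _ (X n)) => //; exact: measurable_snd.
Qed.

Let bm_cvar_past n : @bounded_measurable _ _ (past X n) (cvar n).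
Proof.
apply: (@bm_mean_section _ _ _ (past X n) _ P
  (fun z => linear n z.1 (X n z.2) ^+ 2)).
apply: bmX; apply: (bm_comp (bm_linear_past n) (g := fun z => (z.1, X n z.2))).
apply: measurable_fun_pair; first exact: measurable_fst.
by apply: (@measurableT_comp _ _ _ _ _ _ (X n)) => //; exact: measurable_snd.
Qed.

Let bm_cvar n : bounded_measurable (cvar n).
Proof. exact: bm_past (bm_cvar_past n). Qed.

Let bm_quad_past n : @bounded_measurable _ _ (past X n) (quad n).
Proof.
apply: bm_sum => j; apply: bm_sum => i; apply: (bm_comp bk).
apply: measurable_fun_pair; apply: measurable_fun_past => //.
exact: ltn_trans (ltn_ord i) (ltn_ord j).
Qed.

Let bm_quad n : bounded_measurable (quad n).
Proof. exact: bm_past (bm_quad_past n). Qed.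

(** Given the past, the increment is centered by [degenerate1] and at most m K in absolute value, so
    [centered_mgf_le] bounds its conditional Laplace transform by exp(c^2 cvar m). The condition on
    [c] involves [n] and so serves all steps m <= n. *)
Let quad_supermartingale n m (c : R) : (m <= n)%N ->
  `|c| * (n%:R * K) <= 1 / 2 ->
  mean P (fun w => expR (c * quad m w - c ^+ 2 * \sum_(j < m) cvar j w)) <= 1.
Proof.
move=> + cnK; elim: m => [|m IH] mn.
  under eq_mean do rewrite /quad !big_ord0 !mulr0 subr0 expR0.
  by rewrite mean_cst.
apply: le_trans (IH (ltnW mn)).
pose G w := expR (c * quad m w - c ^+ 2 * \sum_(j < m) cvar j w).
have bG : @bounded_measurable _ _ (past X m) G.
  apply: bm_expR; apply: bmB; apply: bmZ; first exact: bm_quad_past.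
  by apply: bm_sum => j; apply: bm_past_widen (bm_cvar_past j); exact: ltnW.
pose F (z : past X m * T) :=
  G z.1 * expR (- (c ^+ 2 * cvar m z.1)) * expR (c * linear m z.1 z.2).
have bGV : @bounded_measurable _ _ (past X m)
    (fun w => G w * expR (- (c ^+ 2 * cvar m w))).
  by apply: bmM => //; apply: bm_expR; apply: bmN; exact: bmZ.
have bF : bounded_measurable F.
  apply: bmM; last by apply: bm_expR; apply: bmZ; exact: bm_linear_past.
  by apply: (bm_comp bGV); exact: measurable_fst.
rewrite (_ : mean _ _ = mean P (fun w => F (w, X m w))); last first.
  apply: eq_mean => w; rewrite /F /G/= -!expRD /quad !big_ord_recr/=.
  by congr expR; ring.
have bcl w : bounded_measurable (fun w' => linear m w (X m w')).
  by apply: bm_comp (bm_linear m w) _; exact: measurable_funPT.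
rewrite mean_past//; apply: le_mean => [||w].
- apply: (bm_mean_section P (S1 := Omega) (F := fun z => F (z.1, X m z.2))).
  apply: bmM; last by apply: bm_expR; apply: bmZ; exact: bm_linear_full.
  by apply: (bm_comp (bm_past bGV)); exact: measurable_fst.
- exact: bm_past bG.
rewrite /F/= meanZ; last by apply: bm_expR; exact: bmZ.
rewrite -mulrA ler_piMr ?expR_ge0// expRN mulrC ler_pdivrMr ?expR_gt0// mul1r.
apply: (@centered_mgf_le _ _ _ P _ (m%:R * K)) => //.
  rewrite mean_sum => [|i]; last first.
    by apply: bm_comp (bm_pair1 bk _) _; exact: measurable_funPT.
  by rewrite big1.
rewrite (le_trans _ cnK)// ler_wpM2l// ler_wpM2r// ler_nat ltnW//.
Qed.

Let expR_norm_le (y : R) : expR `|y| <= expR y + expR (- y).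
Proof.
by case: (ger0P y) => _; rewrite ?lerDl ?lerDr expR_ge0.
Qed.

(** Degeneracy in the first argument enters here: for a frozen last variable, [linear] is a centered
    i.i.d. sum, of order sqrt(n) rather than n. *)
Let cvar_mgf n j (c : R) : (j < n)%N -> `|c| * (n%:R * K) <= 1 / 2 ->
  mean P (fun w => expR (c ^+ 2 * n%:R * cvar j w)) <=
  2 * expR (c ^+ 4 * n%:R ^+ 5 * K ^+ 4).
Proof.
move=> jn cnK; set t := c ^+ 2 * n%:R; pose b := t * (n%:R * K).
have t0 : 0 <= t by rewrite mulr_ge0// ?sqr_ge0.
have nK0 : 0 <= n%:R * K by rewrite mulr_ge0.
have b0 : 0 <= b by rewrite mulr_ge0.
have bt : bounded_measurable
    (fun z : Omega * Omega => t * linear j z.1 (X j z.2) ^+ 2).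
  by apply: bmZ; apply: bmX; exact: bm_linear_full.
have be := bm_expR bt.
(* Jensen over the last variable, since [cvar] is itself a mean over [w']. *)
apply: (@le_trans _ _ (mean P (fun w => mean P (fun w' =>
    expR (t * linear j w (X j w') ^+ 2))))).
  apply: le_mean => [||w].
  - by apply: bm_expR; exact: bmZ.
  - exact: (bm_mean_section P be).
  rewrite /cvar -meanZ; first by apply: expR_mean_le; exact: (bm_pair1 bt w).
  by apply: bmX; apply: bm_comp (bm_linear j w) _; exact: measurable_funPT.
(* After the exchange the last variable is fixed first, and a bound uniform in its value [y] is
   enough. *)
rewrite (mean_fubini P P be) -[leRHS](mean_cst P).
apply: le_mean => [||w']; [|exact: bm_cst|].
  apply: (bm_mean_section P (S1 := Omega)
    (F := fun z => expR (t * linear j z.2 (X j z.1) ^+ 2))).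
  apply: (bm_comp be (g := fun z : Omega * Omega => (z.2, z.1))).
  by apply: measurable_fun_pair; [exact: measurable_snd|exact: measurable_fst].
set y := X j w'.
have bl : bounded_measurable (fun w => linear j w y).
  exact: bm_past (bm_pair2 (bm_linear_past j) y).
(* One factor of the square is bounded by n K, which turns the exponent t linear^2 into b |linear|;
   the two signs of [linear] give the factor 2. *)
apply: (@le_trans _ _ (mean P (fun w => expR (b * linear j w y) +
    expR (- b * linear j w y)))).
  apply: le_mean; first by apply: bm_expR; apply: bmZ; exact: bmX.
    by apply: bmD; apply: bm_expR; exact: bmZ.
  move=> w; rewrite mulNr; apply: le_trans (expR_norm_le _).
  rewrite ler_expR normrM (ger0_norm b0) /b -(mulrA t) ler_wpM2l//.
  rewrite -real_normK ?num_real// expr2 ler_wpM2r//.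
  by rewrite (le_trans (linear_le _ _ _))// ler_wpM2r// ler_nat ltnW.
have bK : b * K <= 1 / 2.
  have -> : b * K = (`|c| * (n%:R * K)) ^+ 2.
    by rewrite /b /t !exprMn real_normK ?num_real//; ring.
  by have : 0 <= `|c| * (n%:R * K) by [exact: mulr_ge0]; nra.
(* Since b K = c^2 n^2 K^2, the bound n (b K)^2 is c^4 n^5 K^4. *)
have mgf_le (s : R) : `|s| = b ->
    mean P (fun w => expR (s * linear j w y)) <=
      expR (c ^+ 4 * n%:R ^+ 5 * K ^+ 4).
  move=> sb.
  have sK : `|s| * K <= 1 / 2 by rewrite sb.
  have := @iid_sum_mgf_le _ _ _ _ _ _ _ X_iid j
    (fun x => k (x, y)) K s (bm_pair2 bk y)
    (fun x => kK (x, y)) (degenerate2 y 0%N) sK.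
  move=> /le_trans -> //; rewrite ler_expR.
  rewrite exprMn -[s ^+ 2]real_normK ?num_real// sb.
  rewrite (_ : c ^+ 4 * _ * _ = n%:R * (b ^+ 2 * K ^+ 2));
    last by rewrite /b /t; ring.
  by apply: ler_wpM2r; [rewrite mulr_ge0 ?sqr_ge0|rewrite ler_nat ltnW].
rewrite meanD; [|by apply: bm_expR; exact: bmZ..].
rewrite mulr2n mulrDl mul1r; apply: lerD; apply: mgf_le.
  exact: ger0_norm.
by rewrite normrN; exact: ger0_norm.
Qed.

(* Jensen for a finite average, again by the tangent line at the mean. *)
Let expR_average_le n (x : nat -> R) : (0 < n)%N ->
  expR (\sum_(j < n) x j) <= n%:R^-1 * \sum_(j < n) expR (n%:R * x j).
Proof.
move=> n0; have n0R : 0 < n%:R :> R by rewrite ltr0n.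
rewrite ler_pdivlMl//; set m := \sum_(j < n) x j.
apply: (@le_trans _ _ (\sum_(j < n) (expR m * (1 + (n%:R * x j - m))))).
  rewrite -mulr_sumr big_split/= sumrB -mulr_sumr -/m !sumr_const card_ord.
  by rewrite -[m *+ n]mulr_natl subrr addr0 mulrC.
apply: ler_sum => j _.
have /(ler_wpM2l (expR_ge0 m)) := expR_ge1Dx (n%:R * x j - m).
by rewrite -expRD subrKC.
Qed.

(* [expR (c * quad)] is at most the mean of an exponential supermartingale and
   of the exponential of its compensator. *)
Lemma degenerate_mgf_le n (c : R) : (0 < n)%N -> `|c| * (n%:R * K) <= 1 / 4 ->
  mean P (fun w => expR (c * \sum_(j < n) \sum_(i < j) k (X i w, X j w))) <=
  2 * expR (16 * c ^+ 4 * n%:R ^+ 5 * K ^+ 4).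
Proof.
(* The doubling anticipates the split exp(c M) = exp((c' M - V)/2) exp(V/2); it turns the bound 1/4
   into 1/2 and produces 16 = 2^4. *)
move=> n0 cnK; pose c' := 2 * c.
have c'nK : `|c'| * (n%:R * K) <= 1 / 2.
  by rewrite normrM ger0_norm// -mulrA; lra.
rewrite -[X in mean P X]/(fun w => expR (c * quad n w)).
pose V w := c' ^+ 2 * \sum_(j < n) cvar j w.
have bV : bounded_measurable V by apply: bmZ; exact: bm_sum.
have bVj j : bounded_measurable (fun w => expR (n%:R * (c' ^+ 2 * cvar j w))).
  by apply: bm_expR; do 2 apply: bmZ.
have bQ : bounded_measurable (fun w => expR (c' * quad n w - V w)).
  by apply: bm_expR; apply: bmB => //; exact: bmZ.
have n0R : 0 < n%:R :> R by rewrite ltr0n.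
have h1 : mean P (fun w => expR (c' * quad n w - V w)) <= 1.
  exact: quad_supermartingale c'nK.
have h2 : mean P (fun w => expR (V w)) <=
  2 * expR (16 * c ^+ 4 * n%:R ^+ 5 * K ^+ 4).
  (* Jensen over j multiplies each [cvar j] by n, which gives the exponent treated in [cvar_mgf]. *)
  apply: (@le_trans _ _ (mean P (fun w =>
    n%:R^-1 * \sum_(j < n) expR (n%:R * (c' ^+ 2 * cvar j w))))).
    apply: le_mean; [exact: bm_expR|by apply: bmZ; exact: bm_sum|] => w.
    by rewrite /V mulr_sumr;
      exact: (expR_average_le (fun j => c' ^+ 2 * cvar j w)).
  rewrite meanZ ?mean_sum//; last exact: bm_sum.
  rewrite ler_pdivrMl//.
  apply: (@le_trans _ _ (\sum_(j < n)
    2 * expR (16 * c ^+ 4 * n%:R ^+ 5 * K ^+ 4))).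
    apply: ler_sum => j _.
    rewrite (_ : 16 * c ^+ 4 = c' ^+ 4); last by rewrite /c'; ring.
    apply: le_trans (cvar_mgf (ltn_ord j) c'nK).
    rewrite le_eqVlt; apply/orP; left; apply/eqP.
    by apply: eq_mean => w; congr expR; ring.
  by rewrite sumr_const card_ord -[leLHS]mulr_natl.
(* The inequality xy <= (x^2 + y^2)/2 for the two factors of the split. *)
apply: (@le_trans _ _ (mean P (fun w =>
  1 / 2 * expR (c' * quad n w - V w) + 1 / 2 * expR (V w)))).
  apply: le_mean; [by apply: bm_expR; exact: bmZ| |].
    by apply: bmD; apply: bmZ => //; exact: bm_expR.
  move=> w; have -> : expR (c * quad n w) =
    expR ((c' * quad n w - V w) / 2) * expR (V w / 2).
    by rewrite -expRD /c'; congr expR; field.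
  have sq (x : R) : expR x = expR (x / 2) ^+ 2.
    by rewrite -expRM_natr; congr expR; field.
  rewrite (sq (c' * _ - _)) (sq (V w)).
  by have := sqr_ge0 (expR ((c' * quad n w - V w) / 2) - expR (V w / 2)); nra.
rewrite meanD ?meanZ//; [|exact: bm_expR|exact: bmZ|by apply: bmZ;
  exact: bm_expR].
(* With E this exponential, the bound obtained is 1/2 + E, and E >= 1 gives 2 E. *)
have : 1 <= expR (16 * c ^+ 4 * n%:R ^+ 5 * K ^+ 4).
  rewrite -[leLHS]expR0 ler_expR.
  apply: mulr_ge0; last exact: exprn_ge0.
  by rewrite mulr_ge0// mulr_ge0// exprn_even_ge0.
lra.
Qed.

End degenerate.

(** * Tail and neighbourhood probabilities *)

Section log_probability.
Context {R : realType}.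
Local Open Scope ereal_scope.

(** The upper limit is an infimum of suprema over the sets of the filter, and the set where the
    bound holds is one of them. *)
Lemma limn_esup_le_near (u : (\bar R)^nat) (l : \bar R) :
  (\forall n \near \oo, u n <= l) -> limn_esup u <= l.
Proof.
move=> ul; apply: (@le_trans _ _ (ereal_sup (u @` [set n | u n <= l]))).
  by apply: ereal_inf_lbound; exists [set n | u n <= l].
by apply: ge_ereal_sup => _ [n /= h <-].
Qed.

(** The case p = 0, with [lne p] equal to -oo, is included. *)
Lemma scaled_lne_le (s c : R) (p : \bar R) : (0 < s)%R -> 0 <= p ->
  p <= (expR (s * c))%:E -> s^-1%:E * lne p <= c%:E.
Proof.
move=> s0 p0 pc; rewrite muleC lee_pdivrMr// -EFinM mulrC.
rewrite -(expRK (s * c)%R) -lne_EFin ?expR_gt0// lee_lne// in_itv/= ?leey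
  ?andbT//.
Qed.

Lemma le_scaled_lne (s c : R) (p : \bar R) : (0 < s)%R ->
  (expR (s * c))%:E <= p -> c%:E <= s^-1%:E * lne p.
Proof.
move=> s0 pc; rewrite muleC lee_pdivlMr// -EFinM mulrC.
rewrite -(expRK (s * c)%R) -lne_EFin ?expR_gt0// lee_lne// in_itv/= ?leey
  ?andbT//.
by apply: le_trans pc; rewrite lee_fin expR_ge0.
Qed.

End log_probability.

(* With [v = sigma_1^2] the rate function is the Legendre transform of
   [l |-> 2 l^2 v]. *)
Lemma legendre_quadratic {R : realType} (v x : R) : 0 < v ->
  ereal_sup [set (l * x - 2 * l ^+ 2 * v)%:E | l in [set: R]] =
  (x ^+ 2 / (8 * v))%:E.
Proof.
move=> v0; apply/eqP; rewrite eq_le; apply/andP; split.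
  apply: ge_ereal_sup => _ [l _ <-]; rewrite lee_fin ler_pdivlMr; last lra.
  by have := sqr_ge0 (x - 4 * l * v); nra.
apply: ereal_sup_ubound; exists (x / (4 * v)) => //; congr EFin.
by field; rewrite gt_eqF.
Qed.

Lemma measurable_norm_ge {R : realType} (r : R) :
  measurable [set y : R | r <= `|y|].
Proof.
have mN : measurable_fun setT (fun y : R => `|y|).
  exact: measurableT_comp (@measurable_id _ _ _).
have mt : measurable [set true] by [].
have := measurable_fun_ler (measurable_cst r) mN measurableT
  mt.
by rewrite setTI.
Qed.

Lemma measurable_norm_lt {R : realType} (x r : R) :
  measurable [set y : R | `|y - x| < r].
Proof.
have mN : measurable_fun setT (fun y : R => `|y - x|).
  by apply: measurableT_comp => //; exact: measurable_funB.
have mt : measurable [set true] by [].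
have := measurable_fun_ltr mN (measurable_cst r) measurableT
  mt.
by rewrite setTI.
Qed.

Section pointwise.
Context {R : realType}.
Implicit Types a b c r x y z del eta : R.

Let expR_ge1 z : 0 <= z -> 1 <= expR z.
Proof. by move=> z0; rewrite -[leLHS]expR0 ler_expR. Qed.

(** Either |y| >= del or |x| >= r - del, so one of the four exponents is nonnegative. Taking means
    gives a Chernoff bound for a sum of two dependent variables. *)
Lemma one_le_sum_expR a b r del x y : 0 <= a -> 0 <= b -> r <= `|x + y| ->
  1 <= (expR (a * x + a * (del - r)) + expR (- a * x + a * (del - r))) +
       (expR (b * y + - (b * del)) + expR (- b * y + - (b * del))).
Proof.
move=> a0 b0 rxy.
have E1 := expR_ge0 (a * x + a * (del - r)).
have E2 := expR_ge0 (- a * x + a * (del - r)).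
have E3 := expR_ge0 (b * y + - (b * del)).
have E4 := expR_ge0 (- b * y + - (b * del)).
have [yd|yd] := lerP del y.
  by have /expR_ge1 : 0 <= b * y + - (b * del) by [nra]; lra.
have [yd'|yd'] := lerP del (- y).
  by have /expR_ge1 : 0 <= - b * y + - (b * del) by [nra]; lra.
move: rxy; rewrite ler_normr => /orP[rxy|rxy].
  by have /expR_ge1 : 0 <= a * x + a * (del - r) by [nra]; lra.
by have /expR_ge1 : 0 <= - a * x + a * (del - r) by [nra]; lra.
Qed.

(* Where [z] is within [eta] of [x], the first exponential is at most 1; further
   away one of the two exponentials with a shifted slope dominates it. *)
Lemma tilted_expR_le a b c eta x y z del p : 0 <= c -> 0 <= b ->
  2 * eta <= del -> p = - (a * x + `|a| * eta) ->
  (expR (a * z + p) - (expR ((a + c) * z + (p - c * (x + eta))) +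
     expR ((a - c) * z + (p + c * (x - eta))))) -
  (expR (b * y + - (b * eta)) + expR (- b * y + - (b * eta))) <=
  (`|z + y - x| < del)%R%:R.
Proof.
move=> c0 b0 eta_del pE.
have E0 := expR_ge0 (a * z + p).
have E1 := expR_ge0 ((a + c) * z + (p - c * (x + eta))).
have E2 := expR_ge0 ((a - c) * z + (p + c * (x - eta))).
have E3 := expR_ge0 (b * y + - (b * eta)).
have E4 := expR_ge0 (- b * y + - (b * eta)).
have A0 : 0 <= (`|z + y - x| < del)%R%:R :> R by rewrite ler0n.
have [h|zx1] := lerP (x + eta) z.
  suff : expR (a * z + p) <= expR ((a + c) * z + (p - c * (x + eta))) by lra.
  by rewrite ler_expR; nra.
have [h|zx2] := lerP z (x - eta).
  suff : expR (a * z + p) <= expR ((a - c) * z + (p + c * (x - eta))) by lra.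
  by rewrite ler_expR; nra.
have : expR (a * z + p) <= 1.
  rewrite -[leRHS]expR0 ler_expR pE subr_le0 -lerBlDl -mulrBr.
  rewrite (le_trans (ler_norm _))// normrM ler_wpM2l//.
  by rewrite ler_norml; lra.
(* If |y| >= eta, an exponential in [y] is at least 1 and the left side is nonpositive; otherwise |z
   + y - x| < 2 eta <= del. *)
have [h|yd] := lerP eta y.
  by have /expR_ge1 : 0 <= b * y + - (b * eta) by [nra]; lra.
have [h|yd'] := lerP eta (- y).
  by have /expR_ge1 : 0 <= - b * y + - (b * eta) by [nra]; lra.
suff -> : (`|z + y - x| < del) = true by rewrite mulr1n; lra.
rewrite ltr_norml; apply/andP; lra.
Qed.

(** From S y >= 8, exp(S y/2) >= 1 + S y/2 >= 5. In the lower bound four error terms and the target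
    value each take one fifth of the main term. *)
Lemma expR_le_fifth (S y c K : R) : 0 < y -> 8 / y <= S -> c <= K - y / 2 ->
  expR (S * c) <= expR (S * K) / 5.
Proof.
move=> y0 Sy cK; rewrite ler_pdivlMr//.
have S0 : 0 <= S by rewrite (le_trans _ Sy)// divr_ge0// ltW.
apply: (@le_trans _ _ (expR (S * c) * expR (S * (y / 2)))).
  rewrite ler_wpM2l ?expR_ge0//; have := expR_ge1Dx (S * (y / 2)).
  by have : 8 <= S * y; [rewrite -ler_pdivrMr|lra].
by rewrite -expRD ler_expR -mulrDr ler_wpM2l//; lra.
Qed.

End pointwise.

(** * Chernoff upper bound and tilted lower bound *)

Section mdp_from_mgf.
Context (R : realType) (d : measure_display) (Omega : measurableType d).
Context (P : probability Omega R).
Variables (Z : nat -> {RV P >-> R}) (L D : nat -> Omega -> R).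
Variables (s : nat -> R) (v : R).
Hypothesis v0 : 0 < v.
Hypothesis s_oo : s n @[n --> \oo] --> +oo.
Hypothesis bL : forall n, bounded_measurable (L n).
Hypothesis bD : forall n, bounded_measurable (D n).
Hypothesis ZE : \forall n \near \oo, forall w, Z n w = L n w + D n w.
Hypothesis mgfL : forall l e : R, 0 < e -> \forall n \near \oo,
  expR (s n * (2 * l ^+ 2 * v - e)) <= mean P (fun w => expR (s n * l * L n w))
  <= expR (s n * (2 * l ^+ 2 * v + e)).
Hypothesis mgfD : forall th e : R, 0 < e -> \forall n \near \oo,
  mean P (fun w => expR (s n * th * D n w)) <= expR (s n * e).

Let s_large (r : R) : \forall n \near \oo, r <= s n.
Proof. by move/cvgryPge : s_oo => /(_ r). Qed.

Let bmL n (x y : R) : bounded_measurable (fun w => expR (x * L n w + y)).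
Proof. by apply: bm_expR; apply: bmD; [exact: bmZ|exact: bm_cst]. Qed.

Let bmD' n (x y : R) : bounded_measurable (fun w => expR (x * D n w + y)).
Proof. by apply: bm_expR; apply: bmD; [exact: bmZ|exact: bm_cst]. Qed.

Let mean_expR_shift (f : Omega -> R) (x y : R) : bounded_measurable f ->
  mean P (fun w => expR (x * f w + y)) =
    expR y * mean P (fun w => expR (x * f w)).
Proof.
move=> bf; rewrite -meanZ; last by apply: bm_expR; exact: bmZ.
by apply: eq_mean => w; rewrite expRD mulrC.
Qed.

Let mean_add4 (f g h k : Omega -> R) : bounded_measurable f ->
  bounded_measurable g -> bounded_measurable h -> bounded_measurable k ->
  mean P (fun w => (f w + g w) + (h w + k w)) =
  (mean P f + mean P g) + (mean P h + mean P k).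
Proof.
move=> bf bg bh bk.
by rewrite (meanD P (bmD bf bg) (bmD bh bk)) (meanD P bf bg) (meanD P bh bk).
Qed.

Let mean_sub4 (f g h k l : Omega -> R) : bounded_measurable f ->
  bounded_measurable g -> bounded_measurable h -> bounded_measurable k ->
  bounded_measurable l ->
  mean P (fun w => (f w - (g w + h w)) - (k w + l w)) =
  (mean P f - (mean P g + mean P h)) - (mean P k + mean P l).
Proof.
move=> bf bg bh bk bl.
rewrite (meanB P (bmB bf (bmD bg bh)) (bmD bk bl)) (meanB P bf (bmD bg bh)).
by rewrite (meanD P bg bh) (meanD P bk bl).
Qed.

Let measurable_Z n (A : set R) : measurable A -> measurable (Z n @^-1` A).
Proof.
by move=> mA; rewrite -[X in measurable X]setTI; exact: measurable_funPT.
Qed.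

Lemma mdp_tail_le (r e : R) : 0 < r -> 0 < e -> \forall n \near \oo,
  fine (P (Z n @^-1` [set y | r <= `|y|])) <=
  expR (s n * (- (r ^+ 2 / (8 * v)) + e)).
Proof.
(* [l] maximises l r - 2 l^2 v; [del], the share of the threshold left to [D], costs l del = e/4 in
   the exponent. *)
move=> r0 e0; pose l := r / (4 * v); pose del := e / (4 * l).
have l0 : 0 < l by rewrite divr_gt0// mulr_gt0.
have del0 : 0 < del by rewrite divr_gt0// mulr_gt0.
(* With th del equal to the rate at r, the tail of [D] beyond [del] is no larger in exponential
   order than that of [L]. *)
pose th := r ^+ 2 / (8 * v) / del.
have th0 : 0 <= th.
  by rewrite divr_ge0 ?(ltW del0)// divr_ge0 ?sqr_ge0// mulr_ge0// ltW.
have e4 : 0 < e / 4 by rewrite divr_gt0.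
have lde : l * del = e / 4 by rewrite /del; field; rewrite gt_eqF.
have thd : th * del = r ^+ 2 / (8 * v) by rewrite /th divfK// gt_eqF.
have lr : 2 * l ^+ 2 * v - l * r = - (r ^+ 2 / (8 * v)).
  by rewrite /l; field; rewrite gt_eqF.
near=> n.
(* Then exp(s_n e/2) >= 1 + s_n e/2 >= 4 absorbs the number of exponentials. *)
have sn : 6 / e <= s n by near: n; exact: s_large.
have sn0 : 0 < s n by rewrite (lt_le_trans _ sn)// divr_gt0.
have Zn : forall w, Z n w = L n w + D n w by near: n.
have /andP[_ L1] : expR (s n * (2 * l ^+ 2 * v - e / 4)) <=
    mean P (fun w => expR (s n * l * L n w)) <=
    expR (s n * (2 * l ^+ 2 * v + e / 4)) by near: n; exact: (mgfL l e4).
have /andP[_ L2] : expR (s n * (2 * (- l) ^+ 2 * v - e / 4)) <=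
    mean P (fun w => expR (s n * (- l) * L n w)) <=
    expR (s n * (2 * (- l) ^+ 2 * v + e / 4)) by near: n;
      exact: (mgfL (- l) e4).
have D1 : mean P (fun w => expR (s n * th * D n w)) <= expR (s n * (e / 4)).
  by near: n; exact: (mgfD th e4).
have D2 : mean P (fun w => expR (s n * (- th) * D n w)) <= expR (s n * (e / 4)).
  by near: n; exact: (mgfD (- th) e4).
pose A := Z n @^-1` [set y | r <= `|y|].
have mA : measurable A by apply: measurable_Z; exact: measurable_norm_ge.
pose p := s n * l * (del - r); pose q := - (s n * th * del).
rewrite -/A -mean_indic//.
apply: (@le_trans _ _ (mean P (fun w =>
    (expR (s n * l * L n w + p) + expR (s n * (- l) * L n w + p)) +
    (expR (s n * th * D n w + q) + expR (s n * (- th) * D n w + q))))).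
  apply: le_mean; [exact: bm_indic|by do !apply: bmD|] => w.
  rewrite indicE; case: (boolP (w \in A)) => [|_]; last first.
    by rewrite !addr_ge0 ?expR_ge0.
  rewrite inE /A/= Zn => rZ; rewrite /p /q !mulrN.
  by apply: one_le_sum_expR => //; rewrite mulr_ge0// ltW.
rewrite (mean_add4 (bmL _ _ _) (bmL _ _ _) (bmD' _ _ _) (bmD' _ _ _)).
set B := expR (s n * (- (r ^+ 2 / (8 * v)) + e / 2)).
have LB (x : R) : mean P (fun w => expR (x * L n w)) <=
      expR (s n * (2 * l ^+ 2 * v + e / 4)) ->
    mean P (fun w => expR (x * L n w + p)) <= B.
  move=> mL; rewrite (mean_expR_shift x p (bL n)).
  apply: le_trans (ler_wpM2l (expR_ge0 p) mL) _.
  rewrite -expRD ler_expR /p -mulrA -mulrDr ler_wpM2l ?(ltW sn0)//.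
  by rewrite mulrBr lde -lr; clear L1 L2 D1 D2 mL; lra.
have DB (x : R) : mean P (fun w => expR (x * D n w)) <= expR (s n * (e / 4)) ->
    mean P (fun w => expR (x * D n w + q)) <= B.
  move=> mD; rewrite (mean_expR_shift x q (bD n)).
  apply: le_trans (ler_wpM2l (expR_ge0 q) mD) _.
  rewrite -expRD ler_expR /q -mulrA thd -mulrN -mulrDr ler_wpM2l ?(ltW sn0)//.
  by clear L1 L2 D1 D2 LB mD; lra.
have := LB _ L1; move: L2; rewrite sqrrN => /LB L2' L1'.
have D1' := DB _ D1; have D2' := DB _ D2.
apply: (@le_trans _ _ (4 * B)).
  rewrite (_ : 4 * B = (B + B) + (B + B));
    last by clear L1 D1 D2 L1' L2' D1' D2'; lra.
  exact: lerD (lerD L1' L2') (lerD D1' D2').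
clear L1 L1' L2' D1 D2 D1' D2' LB DB Zn.
rewrite (_ : s n * _ = s n * (e / 2) + s n * (- (r ^+ 2 / (8 * v)) + e / 2));
  last first.
  by field; rewrite gt_eqF.
rewrite expRD ler_wpM2r ?expR_ge0//.
have := expR_ge1Dx (s n * (e / 2)).
by have : 6 <= s n * e; [rewrite -ler_pdivrMr|lra].
Unshelve. all: by end_near. Qed.

Lemma mdp_near_ge (x del e : R) : 0 < del -> 0 < e -> \forall n \near \oo,
  expR (s n * (- (x ^+ 2 / (8 * v)) - e)) <=
  fine (P (Z n @^-1` [set y | `|y - x| < del])).
Proof.
move=> del0 e0; pose l := x / (4 * v).
(* Half of [del] is left for [D], and the tilting cost |l| eta is at most e/4; the summand 1 covers
   l = 0. *)
pose eta := Num.min (del / 2) (e / (4 * (1 + `|l|))).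
have l1 : 0 < 1 + `|l| by rewrite ltr_pwDl.
have eta0 : 0 < eta by rewrite lt_min !divr_gt0// mulr_gt0.
have eta_del : 2 * eta <= del.
  by have : eta <= del / 2 by [rewrite ge_min lexx]; lra.
have l_eta : `|l| * eta <= e / 4.
  apply: (@le_trans _ _ ((1 + `|l|) * eta));
    first by rewrite ler_wpM2r ?(ltW eta0)// lerDr.
  have : eta <= e / (4 * (1 + `|l|)) by rewrite ge_min lexx orbT.
  by rewrite ler_pdivlMr ?mulr_gt0//; lra.
(* [t] minimises 2 t^2 v - t eta, with minimum -[kap]. The cross term 4 l t v - t x vanishes because
   4 l v = x, so both shifted slopes gain exactly [kap]. *)
pose kap := eta ^+ 2 / (8 * v); pose t := eta / (4 * v).
have kap0 : 0 < kap by rewrite divr_gt0 ?exprn_gt0// mulr_gt0.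
have t0 : 0 < t by rewrite divr_gt0// mulr_gt0.
(* The Laplace error enters twice, in the main term and in a shifted one; 2 e1 <= kap/2 keeps half
   of the gain. *)
pose e1 := Num.min (e / 8) (kap / 4).
have e10 : 0 < e1 by rewrite lt_min; apply/andP; split; exact: divr_gt0.
have e1e : e1 <= e / 8 by rewrite ge_min lexx.
have e1k : e1 <= kap / 4 by rewrite ge_min lexx orbT.
pose J := x ^+ 2 / (8 * v).
have J0 : 0 <= J by rewrite divr_ge0 ?sqr_ge0// mulr_ge0// ltW.
(* Chosen so that the exponentials in [D] have exponent at most e - (J + 2 e) = -J - e, below that
   of the main term. *)
pose th := (J + 2 * e) / eta.
have th0 : 0 <= th by rewrite divr_ge0 ?(ltW eta0)//; lra.
have thE : th * eta = J + 2 * e by rewrite /th divfK// gt_eqF.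
have lJ : 2 * l ^+ 2 * v = J by rewrite /l /J; field; rewrite gt_eqF.
have lx : l * x = 2 * J by rewrite /l /J; field; rewrite gt_eqF.
have lt1 : 2 * (l + t) ^+ 2 * v - t * x - t * eta = J - kap.
  by rewrite /l /t /J /kap; field; rewrite gt_eqF.
have lt2 : 2 * (l - t) ^+ 2 * v + t * x - t * eta = J - kap.
  by rewrite /l /t /J /kap; field; rewrite gt_eqF.
have tilt1 S : - (S * (l * x + `|l| * eta)) - S * t * (x + eta) +
    S * (2 * (l + t) ^+ 2 * v + e1) = S * (- J - `|l| * eta - kap + e1).
  transitivity (S * ((2 * (l + t) ^+ 2 * v - t * x - t * eta) - l * x
    - `|l| * eta + e1)); first by ring.
  by rewrite lt1 lx; ring.
have tilt2 S : - (S * (l * x + `|l| * eta)) + S * t * (x - eta) +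
    S * (2 * (l - t) ^+ 2 * v + e1) = S * (- J - `|l| * eta - kap + e1).
  transitivity (S * ((2 * (l - t) ^+ 2 * v + t * x - t * eta) - l * x
    - `|l| * eta + e1)); first by ring.
  by rewrite lt2 lx; ring.
(* The exponent guaranteed for the main term; every error exponent and the target -J - e lie below
   it by at least kap/2 or e/2. *)
pose b := - J - `|l| * eta - e1.
have tilt0 : b <= - (l * x + `|l| * eta) + (2 * l ^+ 2 * v - e1).
  by rewrite lJ lx /b; lra.
have b_kap : - J - `|l| * eta - kap + e1 <= b - kap / 2 by rewrite /b; lra.
have b_th : e - (J + 2 * e) <= b - e / 2 by rewrite /b; lra.
have b_e : - J - e <= b - e / 2 by rewrite /b; lra.
near=> n.
have sn : 16 / e <= s n by near: n; exact: s_large.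
have sn' : 8 / kap <= s n by near: n; exact: s_large.
have sn0 : 0 < s n by rewrite (lt_le_trans _ sn)// divr_gt0.
have Zn : forall w, Z n w = L n w + D n w by near: n.
have /andP[M0 _] : expR (s n * (2 * l ^+ 2 * v - e1)) <=
    mean P (fun w => expR (s n * l * L n w)) <=
    expR (s n * (2 * l ^+ 2 * v + e1)) by near: n; exact: (mgfL l e10).
have /andP[_ M1] : expR (s n * (2 * (l + t) ^+ 2 * v - e1)) <=
    mean P (fun w => expR (s n * (l + t) * L n w)) <=
    expR (s n * (2 * (l + t) ^+ 2 * v + e1)) by near: n;
      exact: (mgfL (l + t) e10).
have /andP[_ M2] : expR (s n * (2 * (l - t) ^+ 2 * v - e1)) <=
    mean P (fun w => expR (s n * (l - t) * L n w)) <=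
    expR (s n * (2 * (l - t) ^+ 2 * v + e1)) by near: n;
      exact: (mgfL (l - t) e10).
have D1 : mean P (fun w => expR (s n * th * D n w)) <= expR (s n * e).
  by near: n; exact: (mgfD th e0).
have D2 : mean P (fun w => expR (s n * (- th) * D n w)) <= expR (s n * e).
  by near: n; exact: (mgfD (- th) e0).
pose A := Z n @^-1` [set y | `|y - x| < del].
have mA : measurable A by apply: measurable_Z; exact: measurable_norm_lt.
pose p0 := - (s n * (l * x + `|l| * eta)).
pose p1 := p0 - s n * t * (x + eta).
pose p2 := p0 + s n * t * (x - eta).
pose q := - (s n * th * eta).
rewrite -/A -mean_indic//.
apply: (@le_trans _ _ (mean P (fun w =>
    (expR (s n * l * L n w + p0) - (expR (s n * (l + t) * L n w + p1) +
      expR (s n * (l - t) * L n w + p2))) -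
    (expR (s n * th * D n w + q) + expR (s n * (- th) * D n w + q)))));
      last first.
  apply: le_mean => [||w].
  - by apply: bmB; [apply: bmB => //|]; exact: bmD.
  - exact: bm_indic.
  rewrite indicE (_ : (w \in A) = (`|L n w + D n w - x| < del)); last first.
    by apply/idP/idP; rewrite inE /A/= Zn.
  rewrite /q (mulrN (s n)) (mulrDr (s n)) (mulrBr (s n)).
  apply: tilted_expR_le => //; first by rewrite mulr_ge0// ltW.
    by rewrite mulr_ge0// ltW.
  by rewrite /p0 (normrM (s n)) (gtr0_norm sn0); ring.
rewrite (mean_sub4 (bmL _ _ _) (bmL _ _ _) (bmL _ _ _)
  (bmD' _ _ _) (bmD' _ _ _)).
pose B := expR (s n * b).
have B0 : B <= mean P (fun w => expR (s n * l * L n w + p0)).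
  rewrite (mean_expR_shift _ _ (bL n)).
  apply: le_trans (ler_wpM2l (expR_ge0 p0) M0).
  by rewrite -expRD ler_expR /p0 -(mulrN (s n)) -(mulrDr (s n)) ler_wpM2l
    ?(ltW sn0).
have sne : 8 / e <= s n.
  by apply: le_trans sn; rewrite ler_pM2r ?invr_gt0// ler_nat.
have B1 : mean P (fun w => expR (s n * (l + t) * L n w + p1)) <= B / 5.
  rewrite (mean_expR_shift _ _ (bL n)).
  apply: le_trans (ler_wpM2l (expR_ge0 p1) M1) _.
  by rewrite -expRD tilt1; apply: expR_le_fifth sn' b_kap.
have B2 : mean P (fun w => expR (s n * (l - t) * L n w + p2)) <= B / 5.
  rewrite (mean_expR_shift _ _ (bL n)).
  apply: le_trans (ler_wpM2l (expR_ge0 p2) M2) _.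
  by rewrite -expRD tilt2; apply: expR_le_fifth sn' b_kap.
have qB (y : R) : mean P (fun w => expR (y * D n w)) <= expR (s n * e) ->
    mean P (fun w => expR (y * D n w + q)) <= B / 5.
  move=> me; rewrite (mean_expR_shift _ _ (bD n)).
  apply: le_trans (ler_wpM2l (expR_ge0 q) me) _.
  rewrite -expRD addrC /q -(mulrA (s n)) thE -(mulrBr (s n)).
  exact: expR_le_fifth sne b_th.
have D1' := qB _ D1; have D2' := qB _ D2.
have Be : expR (s n * (- J - e)) <= B / 5 by apply: expR_le_fifth sne b_e.
(* Main term [B] minus four errors of at most B/5 leaves B/5, which dominates the target. *)
apply: (@le_trans _ _ (B / 5)) => //.
rewrite [leLHS](_ : _ = (B - (B / 5 + B / 5)) - (B / 5 + B / 5)); last by field.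
exact: lerB (lerB B0 (lerD B1 B2)) (lerD D1' D2').
Unshelve. all: by end_near. Qed.

End mdp_from_mgf.

(** * From probabilities to the large deviation principle *)

Lemma quadratic_good_rate {R : realType} (v : R) : 0 < v ->
  good_rate_function (fun x : R => (x ^+ 2 / (8 * v))%:E).
Proof.
move=> v0 alpha alpha0; have v8 : 0 < 8 * v by rewrite mulr_gt0.
have av : 0 <= alpha * (8 * v) by rewrite mulr_ge0// ltW.
rewrite (_ : [set x | _] =
  `[- Num.sqrt (alpha * (8 * v)), Num.sqrt (alpha * (8 * v))]%classic).
  exact: segment_compact.
apply/seteqP; split => x /=; rewrite lee_fin ler_pdivrMr// in_itv/= -ler_norml.
  by move=> h; rewrite -sqrtr_sqr ler_sqrt.
move=> h; rewrite -(sqr_sqrtr av).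
by rewrite -real_normK ?num_real// lerXn2r// nnegrE.
Qed.

Section quadratic_ldp.
Context (R : realType) (d : measure_display) (Omega : measurableType d).
Context (P : probability Omega R).
Variables (Z : nat -> {RV P >-> R}) (s : nat -> R) (v : R).
Hypothesis v0 : 0 < v.
Hypothesis s_oo : s n @[n --> \oo] --> +oo.
Hypothesis tail_le : forall r e : R, 0 < r -> 0 < e -> \forall n \near \oo,
  fine (P (Z n @^-1` [set y | r <= `|y|])) <=
  expR (s n * (- (r ^+ 2 / (8 * v)) + e)).
Hypothesis near_ge : forall x del e : R, 0 < del -> 0 < e ->
  \forall n \near \oo, expR (s n * (- (x ^+ 2 / (8 * v)) - e)) <=
  fine (P (Z n @^-1` [set y | `|y - x| < del])).

Let I (x : R) : \bar R := (x ^+ 2 / (8 * v))%:E.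
Let rate (G : set R) n : \bar R :=
  ((s n)^-1%:E * lne (distribution P (Z n) G))%E.

Let v8 : 0 < 8 * v. Proof. by rewrite mulr_gt0. Qed.

Let s_gt0 : \forall n \near \oo, 0 < s n.
Proof. by move/cvgryPgt : s_oo => /(_ 0). Qed.

Let preimage_measurable n (A : set R) :
  measurable A -> measurable (Z n @^-1` A).
Proof.
by move=> mA; rewrite -[X in measurable X]setTI; exact: measurable_funPT.
Qed.

(** As the rate depends only on |x| and increases with it, [G] lies in the symmetric tail beyond
    sqrt(8 v r). One tail bound thus serves all sets, with no covering argument. For r <= 0 the
    bound exceeds 1. *)
Let tail_rate (G : set R) (r e : R) : measurable G -> 0 < e ->
  (forall x, G x -> r <= x ^+ 2 / (8 * v)) ->
  \forall n \near \oo, (rate G n <= (- r + e)%:E)%E.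
Proof.
move=> mG e0 Gr; have [r0|r0] := lerP r 0.
  near=> n; have sn : 0 < s n by near: n.
  apply: scaled_lne_le => //; apply: le_trans (probability_le1 _ mG) _.
  by rewrite lee_fin -[leLHS]expR0 ler_expR mulr_ge0// ?(ltW sn)//; lra.
pose rho := Num.sqrt (r * (8 * v)).
have rv : 0 < r * (8 * v) by rewrite mulr_gt0.
have rho0 : 0 < rho by rewrite sqrtr_gt0.
have rhoE : rho ^+ 2 / (8 * v) = r.
  by rewrite sqr_sqrtr ?(ltW rv)// mulfK// gt_eqF.
near=> n; have sn : 0 < s n by near: n.
apply: scaled_lne_le => //.
have : fine (P (Z n @^-1` [set y | rho <= `|y|])) <=
    expR (s n * (- (rho ^+ 2 / (8 * v)) + e)) by near: n; exact: tail_le.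
rewrite rhoE -lee_fin; apply: le_trans.
have mt : measurable [set y : R | rho <= `|y|] by exact: measurable_norm_ge.
rewrite fineK; last by apply: fin_num_measure; exact: preimage_measurable.
rewrite /distribution /pushforward/=; apply: le_measure.
- by rewrite inE; exact: preimage_measurable.
- by rewrite inE; exact: preimage_measurable.
move=> w /Gr /=; rewrite ler_pdivlMr// => h.
by rewrite -sqrtr_sqr ler_sqrt// sqr_ge0.
Unshelve. all: by end_near. Qed.

Lemma quadratic_ldp : satisfies_mdp Z s I.
Proof.
split => //; first exact: quadratic_good_rate.
move=> G mG; split.
(* The lower limit is minus the upper limit of the opposite sequence, which reduces the claim to one
   interior point [x] at a time, with a ball around it inside [G]. *)
- rewrite /limn_einf leeNl oppeK; apply: le_ereal_inf_tmp => _ [x Gx <-].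
  apply/lee_addgt0Pr => e e0; apply: limn_esup_le_near.
  have [del /= del0 ballG] : \forall y \near x, G y by [].
  near=> n; have sn : 0 < s n by near: n.
  rewrite leeNl -EFinD -EFinN opprD; apply: le_scaled_lne => //.
  have : expR (s n * (- (x ^+ 2 / (8 * v)) - e)) <=
    fine (P (Z n @^-1` [set y | `|y - x| < del])) by near: n; exact: near_ge.
  rewrite -lee_fin => /le_trans; apply.
  have mt : measurable [set y : R | `|y - x| < del].
    exact: measurable_norm_lt.
  rewrite fineK; last by apply: fin_num_measure; exact: preimage_measurable.
  rewrite /distribution /pushforward/=; apply: le_measure.
  + by rewrite inE; exact: preimage_measurable.
  + by rewrite inE; exact: preimage_measurable.
  by move=> w /= h; apply: ballG; rewrite /ball_/= distrC.
- exact: limn_einf_sup.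
case E : (ereal_inf (I @` closure G)) => [r| |]; last by rewrite /= leey.
- apply/lee_addgt0Pr => e e0; rewrite -EFinN -EFinD.
  apply: limn_esup_le_near; apply: tail_rate => // x Gx.
  rewrite -lee_fin -E; apply: ereal_inf_lbound; exists x => //.
  exact: subset_closure.
(* The rate is finite everywhere, so an infimum +oo forces [G] to be empty; the scaled logarithm is
   then -oo. *)
have G0 x : ~ G x.
  move=> Gx; suff : (ereal_inf (I @` closure G) <= I x)%E by rewrite E.
  by apply: ereal_inf_lbound; exists x => //; exact: subset_closure.
apply: limn_esup_le_near; near=> n; have sn : 0 < s n by near: n.
rewrite (_ : G = set0); last by apply/seteqP; split => // x /G0.
by rewrite measure0 le0_lneNy// gt0_muleNy// lte_fin invr_gt0.
Unshelve. all: by end_near. Qed.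

End quadratic_ldp.

(** * Hoeffding decomposition *)

Lemma bin2_natr {R : realType} n : (0 < n)%N ->
  'C(n, 2)%:R = n%:R * (n%:R - 1) / 2 :> R.
Proof.
case: n => // n _; have := mul_bin_diag n.+1 1.
rewrite bin1/= => /(congr1 (fun k => k%:R : R));
  rewrite !natrM -[n.+1]addn1 natrD.
by move=> h; rewrite addrK h mulrAC divff ?mul1r// gt_eqF.
Qed.

(** Each index belongs to n - 1 pairs. *)
Lemma sum_pairs {R : realType} (f : nat -> R) n :
  \sum_(j < n) \sum_(i < j) (f i + f j) = (n%:R - 1) * \sum_(i < n) f i.
Proof.
elim: n => [|n IH]; first by rewrite !big_ord0 mulr0.
rewrite !big_ord_recr/= IH big_split/= sumr_const card_ord -mulr_natl.
by rewrite -natr1; ring.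
Qed.

Lemma sum_pairs_exchange {R : realType} (g : nat -> nat -> R) n :
  \sum_(i < n) \sum_(j < n | (i < j)%N) g i j = \sum_(j < n) \sum_(i < j) g i j.
Proof.
rewrite (exchange_big_dep predT)//=; apply: eq_bigr => j _.
by rewrite (big_ord_widen_cond n predT (fun i => g i j)) // ltnW.
Qed.

Section hoeffding.
Context (R : realType) (d d' : measure_display).
Context (Omega : measurableType d) (T : measurableType d').
Context (P : probability Omega R) (X : nat -> {RV P >-> T}).
Variable h : {mfun (T * T)%type >-> R}.
Hypothesis X_iid : iid X.
Hypothesis h_sym : forall x y : T, h (x, y) = h (y, x).
Hypothesis h_bounded : bounded_fun (h : T * T -> R).
Hypothesis U_centered : Ustat_centered X h.

Let X_indep : mutually_independent X. Proof. by case: X_iid. Qed.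
Let X_id : identically_distributed X. Proof. by case: X_iid. Qed.

Lemma bm_kernel : bounded_measurable (h : T * T -> R).
Proof.
split; first exact: measurable_funPT.
have [M [Mreal hM]] := h_bounded; exists (M + 1) => z.
by apply: hM => //; rewrite ltrDl.
Qed.

Let bm_kernel_X x i : bounded_measurable (fun w => h (x, X i w)).
Proof. by apply: bm_comp (bm_pair1 bm_kernel x) _; exact: measurable_funPT. Qed.

(** The definition fixes the index 1, but degeneracy of [h2] is needed for every index. *)
Lemma h1E i x : h1 X h x = mean P (fun w => h (x, X i w)).
Proof.
by rewrite /h1 unlock (mean_iid X_id i 1 (bm_pair1 bm_kernel x)).
Qed.

Lemma bm_h1 : bounded_measurable (h1 X h).
Proof.
rewrite (_ : h1 X h = fun x => mean P (fun w => h (x, X 0%N w))); last first.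
  by apply/funext => x; exact: h1E.
apply: (@bm_mean_section _ _ _ T _ P (fun z => h (z.1, X 0%N z.2))).
apply: (bm_comp bm_kernel (g := fun z : T * Omega => (z.1, X 0%N z.2))).
apply: measurable_fun_pair; first exact: measurable_fst.
by apply: (@measurableT_comp _ _ _ _ _ _ (X 0%N)) => //; exact: measurable_snd.
Qed.

Let bm_h1X i : bounded_measurable (fun w => h1 X h (X i w)).
Proof. by apply: bm_comp bm_h1 _; exact: measurable_funPT. Qed.

(** [X 0] is measurable for [past X 1], so averaging [X 1] out of the centering identity leaves the
    mean of h1(X 0). *)
Lemma mean_h1 i : mean P (fun w => h1 X h (X i w)) = 0.
Proof.
rewrite (mean_iid X_id i 0%N bm_h1).
have : mean P (fun w => h (X 0%N w, X 1%N w)) = 0.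
  by move: U_centered; rewrite /Ustat_centered unlock /mean /Rintegral => ->.
have bF : bounded_measurable (fun z : past X 1 * T => h (X 0%N z.1, z.2)).
  apply: (bm_comp bm_kernel (g := fun z : past X 1 * T => (X 0%N z.1, z.2))).
  apply: measurable_fun_pair; last exact: measurable_snd.
  apply: (@measurableT_comp _ _ _ _ _ _ (X 0%N : past X 1 -> T)).
    exact: measurable_fun_past.
  exact: measurable_fst.
have /= -> := mean_past X_indep bF.
by move=> <-; apply: eq_mean => w; exact: h1E.
Qed.

Lemma sigma1_sqrE : sigma1_sqr X h = mean P (fun w => h1 X h (X 0%N w) ^+ 2).
Proof.
rewrite /sigma1_sqr /variance unlock.
rewrite (_ : fine 'E_P[h1 X h \o X 0%N] = 0); last first.
  by rewrite -[RHS](mean_h1 0) unlock.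
rewrite unlock; congr fine; apply: eq_integral => w _.
by congr EFin; rewrite expr2 -[in RHS](subr0 (h1 X h _)).
Qed.

(** The constant term of the Hoeffding projection is E h = 0 by centering. *)
Let h2 (z : T * T) : R := h z - h1 X h z.1 - h1 X h z.2.

Let bm_h2 : bounded_measurable h2.
Proof.
apply: (bmB (bmB bm_kernel _)).
  by apply: (bm_comp bm_h1); exact: measurable_fst.
by apply: (bm_comp bm_h1); exact: measurable_snd.
Qed.

Let h2_degenerate x i : mean P (fun w => h2 (x, X i w)) = 0.
Proof.
rewrite -[LHS]/(mean P (fun w => h (x, X i w) - h1 X h x - h1 X h (X i w))).
rewrite (meanB P (bmB (bm_kernel_X x i) (bm_cst _)) (bm_h1X i)).
rewrite (meanB P (bm_kernel_X x i) (bm_cst _)).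
by rewrite mean_cst mean_h1 (h1E i) subrr subr0.
Qed.

Let h2_degenerate' y i : mean P (fun w => h2 (X i w, y)) = 0.
Proof.
rewrite -[RHS](h2_degenerate y i); apply: eq_mean => w.
by rewrite /h2/= h_sym; ring.
Qed.

Let pairs n w := \sum_(j < n) \sum_(i < j) h2 (X i w, X j w).

(** [sum_pairs] contributes the factor n - 1, and (n - 1) / C(n, 2) = 2/n. *)
Lemma hoeffding_decomposition n w : (1 < n)%N -> Ustat X h n w =
  2 / n%:R * (\sum_(i < n) h1 X h (X i w)) + ('C(n, 2)%:R)^-1 * pairs n w.
Proof.
move=> n1; rewrite /Ustat (sum_pairs_exchange (fun i j => h (X i w, X j w))).
have n0 : 0 < n%:R :> R by rewrite ltr0n ltnW.
have n1R : 0 < n%:R - 1 :> R by rewrite subr_gt0 ltr1n.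
have -> : \sum_(j < n) \sum_(i < j) h (X i w, X j w) =
    pairs n w + (n%:R - 1) * \sum_(i < n) h1 X h (X i w).
  rewrite -(sum_pairs (fun i => h1 X h (X i w))) /pairs -big_split/=.
  apply: eq_bigr => j _; rewrite -big_split/=; apply: eq_bigr => i _.
  by rewrite /h2/=; ring.
rewrite bin2_natr ?(ltnW n1)//; field.
by rewrite !gt_eqF.
Qed.

(** * Speed and Laplace transforms of the two parts of the scaled statistic *)

Variable a : nat -> R.
Hypothesis U_nondegenerate : Ustat_nondegenerate X h.
Hypothesis a_gt0 : forall n : nat, 0 < a n.
Hypothesis a_lower : Num.sqrt (n%:R : R) / a n @[n --> \oo] --> (0 : R).
Hypothesis a_upper : n%:R / a n @[n --> \oo] --> +oo.

Let s n := a n ^+ 2 / n%:R.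
Let v := sigma1_sqr X h.

Let natr_gt0 : \forall n \near \oo, 0 < n%:R :> R.
Proof. by exists 1%N => // n /=; rewrite ltr0n. Qed.

Lemma speed_cvgy : s n @[n --> \oo] --> +oo.
Proof.
(* [M] may be negative; [A] is a positive bound above it, so that sqrt(n)/a_n < 1/sqrt(A) can be
   squared and inverted. *)
apply/cvgryPge => M; pose A := `|M| + 1.
have A0 : 0 < A by rewrite ltr_wpDl.
have iA : 0 < (Num.sqrt A)^-1 by rewrite invr_gt0 sqrtr_gt0.
near=> n; have n0 : 0 < n%:R :> R by near: n.
have : `|0 - Num.sqrt n%:R / a n| < (Num.sqrt A)^-1.
  by near: n; move/cvgrPdist_lt : a_lower; exact.
rewrite sub0r normrN ger0_norm ?divr_ge0 ?sqrtr_ge0 ?(ltW (a_gt0 n))//.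
rewrite ltr_pdivrMr// mulrC ltr_pdivlMr ?sqrtr_gt0// => lt_a.
rewrite /s ler_pdivlMr//; apply: (@le_trans _ _ (A * n%:R)).
  by rewrite ler_wpM2r ?(ltW n0)// /A; have := ler_norm M; lra.
rewrite -(sqr_sqrtr (ltW A0)) -(sqr_sqrtr (ltW n0)) -exprMn mulrC.
by rewrite lerXn2r ?nnegrE ?(ltW lt_a)// ?(ltW (a_gt0 n))// mulr_ge0 ?sqrtr_ge0.
Unshelve. all: by end_near. Qed.

Let a_le (eta : R) : 0 < eta -> \forall n \near \oo, a n <= eta * n%:R.
Proof.
move=> eta0; near=> n; have n0 : 0 < n%:R :> R by near: n.
have : eta^-1 <= n%:R / a n by near: n; move/cvgryPge : a_upper; exact.
by rewrite ler_pdivlMr// ler_pdivrMl.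
Unshelve. all: by end_near. Qed.

Let linear_part n w := 2 / a n * \sum_(i < n) h1 X h (X i w).
Let degenerate_part n w := n%:R / a n / 'C(n, 2)%:R * pairs n w.

(** The exponent is t times the sum of the h1(X_i) with t = 2 l a_n/n, which tends to 0. Since t^2 n
    = 4 l^2 s_n, the n-th power of exp(t^2 v/2) is exp(2 l^2 v s_n). *)
Let linear_part_mgf (l e : R) : 0 < e -> \forall n \near \oo,
  expR (s n * (2 * l ^+ 2 * v - e)) <=
  mean P (fun w => expR (s n * l * linear_part n w)) <=
  expR (s n * (2 * l ^+ 2 * v + e)).
Proof.
move=> e0; have [K hK] := bm_h1.2.
(* The error [e'] reappears multiplied by 4 l^2; the summand 1 covers l = 0. *)
pose e' := e / (4 * l ^+ 2 + 1).
have l0 : 0 < 4 * l ^+ 2 + 1 by have := sqr_ge0 l; lra.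
have e'0 : 0 < e' by rewrite divr_gt0.
have le' : 4 * l ^+ 2 * e' <= e.
  by rewrite /e' mulrA ler_pdivrMr// mulrC ler_wpM2l ?(ltW e0)// lerDl.
have [eta eta0 mgf] := centered_mgf_asymp (bm_h1X 0%N) (fun w => hK (X 0%N w))
  (mean_h1 0%N) e'0.
rewrite -sigma1_sqrE -/v in mgf.
near=> n; have n0 : 0 < n%:R :> R by near: n.
have an := a_gt0 n.
have aeta : a n <= eta / (2 * `|l| + 1) * n%:R.
  by near: n; apply: a_le; rewrite divr_gt0// ltr_wpDl// mulr_ge0.
pose t := 2 * l * a n / n%:R.
have t_eta : `|t| <= eta.
  rewrite /t !normrM normfV (gtr0_norm an) (gtr0_norm n0) ger0_norm//.
  rewrite ler_pdivrMr//; move: aeta; rewrite mulrAC ler_pdivlMr; last first.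
    by rewrite ltr_wpDl// mulr_ge0.
  by apply: le_trans; have := normr_ge0 l; nra.
have tn : t ^+ 2 * n%:R = 4 * l ^+ 2 * s n.
  by rewrite /t /s; field; rewrite gt_eqF.
have -> : mean P (fun w => expR (s n * l * linear_part n w)) =
    mean P (fun w => expR (t * h1 X h (X 0%N w))) ^+ n.
  rewrite -(mgf_iid_sum X_iid n (bmZ t bm_h1)); apply: eq_mean => w; congr expR.
  rewrite -mulr_sumr /linear_part mulrA; congr (_ * _).
  by rewrite /t /s; field; rewrite !gt_eqF.
have s0 : 0 <= s n by rewrite divr_ge0// sqr_ge0.
have /andP[m1 m2] := mgf t t_eta.
apply/andP; split.
  apply: (@le_trans _ _ (expR (t ^+ 2 * (v / 2 - e')) ^+ n)).
    rewrite -expRM_natr ler_expR (mulrAC (t ^+ 2)) tn.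
    rewrite [leRHS](_ : _ = s n * (2 * l ^+ 2 * v - 4 * l ^+ 2 * e'));
      last by field.
    by rewrite ler_wpM2l// lerB.
  by rewrite lerXn2r ?nnegrE ?expR_ge0// mean_ge0// => w; exact: expR_ge0.
apply: (@le_trans _ _ (expR (t ^+ 2 * (v / 2 + e')) ^+ n)).
  by rewrite lerXn2r ?nnegrE ?expR_ge0// mean_ge0// => w; exact: expR_ge0.
rewrite -expRM_natr ler_expR (mulrAC (t ^+ 2)) tn.
rewrite [leLHS](_ : _ = s n * (2 * l ^+ 2 * v + 4 * l ^+ 2 * e'));
  last by field.
by rewrite ler_wpM2l// lerD.
Unshelve. all: by end_near. Qed.

(** The coefficient of [pairs] is c = th a_n / C(n, 2), of order at most a_n/n^2. The bound c^4 n^5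
    is then of order a_n^4/n^3 = s_n (a_n/n)^2, which is o(s_n). *)
Let degenerate_part_mgf (th e : R) : 0 < e -> \forall n \near \oo,
  mean P (fun w => expR (s n * th * degenerate_part n w)) <= expR (s n * e).
Proof.
move=> e0; have [K hK] := bm_h2.2.
have K0 : 0 <= K := le_trans (normr_ge0 _) (hK point).
(* From |c| n^2 <= 4 |th| a_n and a_n <= eta n, the range condition |c| n K <= 1/4 follows once 16
   |th| K eta <= 1. *)
pose A := 16 * `|th| * K + 1.
have thK : 0 <= `|th| * K by rewrite mulr_ge0.
have A1 : 1 <= A by rewrite /A; lra.
(* Gives both eta A <= 1, for the range condition, and A^4 eta^2 <= e/2, for the final exponent. *)
pose eta := Num.min 1 (e / 2) / A ^+ 4.
have A4 : 1 <= A ^+ 4 by rewrite exprn_ege1.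
have m0 : 0 < Num.min 1 (e / 2) by rewrite lt_min ltr01 divr_gt0.
have eta0 : 0 < eta by rewrite divr_gt0//; lra.
have etaA : eta * A ^+ 4 = Num.min 1 (e / 2) by rewrite /eta divfK// gt_eqF//;
  lra.
have eta1 : eta * A <= 1.
  apply: (@le_trans _ _ (eta * A ^+ 4)); last by rewrite etaA ge_min lexx.
  by rewrite ler_wpM2l ?(ltW eta0)// -{1}[A]expr1 ler_weXn2l.
have eta1' : eta <= 1.
  apply: le_trans eta1; rewrite ler_peMr// ltW//.
have etae : A ^+ 4 * eta ^+ 2 <= e / 2.
  rewrite expr2 mulrA (mulrC (A ^+ 4)) etaA.
  apply: (@le_trans _ _ (e / 2 * 1)); last by rewrite mulr1.
  apply: ler_pM => //; [exact: ltW|exact: ltW|].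
  by rewrite ge_min lexx orbT.
near=> n; have an := a_gt0 n.
have n2 : (1 < n)%N by near: n; exists 2%N.
have n2R : 2 <= n%:R :> R by rewrite ler_nat.
have n0 : 0 < n%:R :> R by lra.
have aeta : a n <= eta * n%:R by near: n; exact: a_le.
have se : 2 / e <= s n by near: n; move/cvgryPge : speed_cvgy; exact.
pose c := th * a n / 'C(n, 2)%:R.
have C0 : 0 < 'C(n, 2)%:R :> R by rewrite ltr0n bin_gt0.
have Cn : n%:R ^+ 2 / 4 <= 'C(n, 2)%:R :> R.
  by rewrite bin2_natr ?(ltnW n2)//; nra.
have cn : `|c| * n%:R ^+ 2 <= 4 * `|th| * a n.
  rewrite /c !normrM normfV (gtr0_norm an) (gtr0_norm C0).
  rewrite mulrAC ler_pdivrMr//.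
  by have : 0 <= `|th| * a n by [rewrite mulr_ge0// ltW]; nra.
have cnK : `|c| * (n%:R * K) <= 1 / 4.
  have : `|c| * (n%:R * K) * n%:R <= 1 / 4 * n%:R; last by rewrite ler_pM2r.
  rewrite (_ : _ * _ * _ = `|c| * n%:R ^+ 2 * K); last by ring.
  apply: le_trans (ler_wpM2r K0 cn) _.
  apply: (@le_trans _ _ (4 * `|th| * K * (eta * n%:R))).
    by rewrite mulrAC ler_wpM2l// -mulrA mulr_ge0.
  by rewrite mulrA ler_wpM2r ?(ltW n0)//; move: eta1; rewrite /A; lra.
rewrite (_ : mean _ _ = mean P (fun w => expR (c * pairs n w))); last first.
  apply: eq_mean => w; congr expR; rewrite /degenerate_part /c /s.
  by field; rewrite !gt_eqF.
apply: (le_trans (degenerate_mgf_le X_iid bm_h2 hK h2_degenerate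
  h2_degenerate' (ltnW n2) cnK)).
(* The prefactor 2 is at most exp(1), which s_n >= 2/e absorbs into the other half of the exponent
   s_n e. *)
apply: (@le_trans _ _ (expR 1 * expR (s n * (e / 2)))); last first.
  rewrite -expRD ler_expR.
  by move: se; rewrite ler_pdivrMr//; lra.
apply: ler_pM; [by []|exact: expR_ge0| |].
  by have := expR_ge1Dx (1 : R); lra.
rewrite ler_expR.
have c4 : c ^+ 4 * n%:R ^+ 5 * K ^+ 4 <=
  (4 * `|th| * K) ^+ 4 * (a n ^+ 4 / n%:R ^+ 3).
  have : (`|c| * n%:R ^+ 2 * K) ^+ 4 <= (4 * `|th| * a n * K) ^+ 4.
    by rewrite lerXn2r ?nnegrE ?mulr_ge0 ?exprn_ge0 ?(ltW an)// ler_wpM2r.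
  have c4E : c ^+ 4 = `|c| ^+ 4 by rewrite -normrX ger0_norm// exprn_even_ge0.
  move=> bnd4; rewrite c4E [leRHS]mulrA ler_pdivlMr ?exprn_gt0//.
  by move: bnd4; rewrite !exprMn; lra.
have an4 : a n ^+ 4 / n%:R ^+ 3 = s n * (a n / n%:R) ^+ 2.
  by rewrite /s; field; rewrite gt_eqF.
have s0 : 0 <= s n by rewrite divr_ge0 ?sqr_ge0// ltW.
have an2 : (a n / n%:R) ^+ 2 <= eta ^+ 2.
  apply: lerXn2r; rewrite ?nnegrE ?(ltW eta0)//; last by rewrite ler_pdivrMr.
  by apply: divr_ge0; exact: ltW.
have A4' : 16 * (4 * `|th| * K) ^+ 4 <= A ^+ 4.
  have : (16 * `|th| * K) ^+ 4 <= A ^+ 4.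
    rewrite lerXn2r ?nnegrE ?(le_trans ler01 A1)//; last by rewrite /A lerDl.
    by rewrite -mulrA mulr_ge0.
  have : 0 <= (4 * `|th| * K) ^+ 4 by rewrite exprn_ge0// -mulrA mulr_ge0.
  rewrite (_ : 16 * `|th| * K = 4 * (4 * `|th| * K)); last by ring.
  by rewrite exprMn; lra.
rewrite -2!mulrA [c ^+ 4 * _]mulrA.
apply: (@le_trans _ _ (16 * ((4 * `|th| * K) ^+ 4 * (s n * eta ^+ 2)))).
  rewrite ler_wpM2l// (le_trans c4)// an4 ler_wpM2l ?ler_wpM2l//.
  by rewrite exprn_ge0// -mulrA mulr_ge0.
rewrite mulrA (le_trans (ler_wpM2r _ A4'))//;
  first by rewrite mulr_ge0 ?sqr_ge0.
by rewrite mulrCA ler_wpM2l.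
Unshelve. all: by end_near. Qed.

Let bm_linear_part n : bounded_measurable (linear_part n).
Proof. by apply: bmZ; exact: bm_sum. Qed.

Let bm_degenerate_part n : bounded_measurable (degenerate_part n).
Proof.
apply: bmZ; apply: bm_sum => j; apply: bm_sum => i; apply: (bm_comp bm_h2).
by apply: measurable_fun_pair; exact: measurable_funPT.
Qed.

Let scaled_UstatE : \forall n \near \oo, forall w,
  scaled_Ustat X h a n w = linear_part n w + degenerate_part n w.
Proof.
exists 2%N => // n /= n2 w.
rewrite -[LHS]/(Ustat X h n w * (n%:R / a n)) hoeffding_decomposition//.
rewrite /linear_part /degenerate_part; field.
by rewrite !gt_eqF// ltr0n ?bin_gt0// ltnW.
Qed.

Lemma scaled_Ustat_mdp : satisfies_mdp (scaled_Ustat X h a)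
  (fun n => a n ^+ 2 / n%:R)
  (fun x => (x ^+ 2 / (8 * sigma1_sqr X h))%:E).
Proof.
apply: quadratic_ldp => //; first exact: speed_cvgy.
- exact: (mdp_tail_le U_nondegenerate speed_cvgy bm_linear_part
    bm_degenerate_part scaled_UstatE linear_part_mgf degenerate_part_mgf).
- exact: (mdp_near_ge U_nondegenerate speed_cvgy bm_linear_part
    bm_degenerate_part scaled_UstatE linear_part_mgf degenerate_part_mgf).
Qed.

End hoeffding.

Theorem theorem3p1 (R : realType) (d d' : measure_display)
  (Omega : measurableType d) (T : measurableType d')
  (P : probability Omega R) (X : nat -> {RV P >-> T})
  (h : {mfun (T * T)%type >-> R}) (a : nat -> R)
  (X_iid : iid X)
  (h_sym : forall x y : T, h (x, y) = h (y, x))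
  (h_bounded : bounded_fun (h : T * T -> R))
  (U_nondegenerate : Ustat_nondegenerate X h)
  (U_centered : Ustat_centered X h)
  (a_gt0 : forall n : nat, 0 < a n)
  (a_lower : Num.sqrt (n%:R : R) / a n @[n --> \oo] --> (0 : R))
  (a_upper : n%:R / a n @[n --> \oo] --> +oo) :
  let I : R -> \bar R := fun x =>
    ereal_sup [set (l * x - 2 * l ^+ 2 * sigma1_sqr X h)%:E | l in [set: R]] in
  satisfies_mdp (scaled_Ustat X h a) (fun n => a n ^+ 2 / n%:R) I /\
  (forall x : R, I x = (x ^+ 2 / (8 * sigma1_sqr X h))%:E).
Proof.
move=> I; have IE x : I x = (x ^+ 2 / (8 * sigma1_sqr X h))%:E.
  exact: legendre_quadratic.
split => //; rewrite (_ : I = fun x => (x ^+ 2 / (8 * sigma1_sqr X h))%:E).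
  exact: scaled_Ustat_mdp.
by apply/funext.
Qed.
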